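(* Let $\tau\in\mathfrak M_{1,c}(\mathrm{Rat})$ with $J_{\ker}(G_\tau)=\emptyset$, $J(G_\tau)\ne\emptyset$ and $S_\tau\subset F(G_\tau)$, and let $\alpha\in(0,1)$, $\lambda\in(0,1)$ be constants as in the exponential-convergence theorem (so that, for some $C>0$, $\|M_\tau^n(\varphi-\pi_\tau(\varphi))\|_\alpha\le C\lambda^n\|\varphi\|_\alpha$ for all $\varphi\in C^\alpha(\hat{\mathbb C})$, $n\in\mathbb N$, and $\mathrm{LS}(\mathcal U_{f,\tau}(\hat{\mathbb C}))\subset C^\alpha(\hat{\mathbb C})$). Let $\mathrm{Spec}_\alpha(M_\tau)$ be the spectrum of $M_\tau:C^\alpha(\hat{\mathbb C})\to C^\alpha(\hat{\mathbb C})$. Then: (1) $\mathrm{Spec}_\alpha(M_\tau)\subset\{z\in\mathbb C:|z|\le\lambda\}\cup\mathcal U_{v,\tau}(\hat{\mathbb C})$; (2) for every $\zeta\in\mathbb C\setminus(\{|z|\le\lambda\}\cup\mathcal U_{v,\tau}(\hat{\mathbb C}))$, $$(\zeta I-M_\tau)^{-1}=(\zeta I-M_\tau)|_{\mathrm{LS}(\mathcal U_{f,\tau}(\hat{\mathbb C}))}^{-1}\circ\pi_\tau+\sum_{n=0}^\infty\frac{M_\tau^n}{\zeta^{n+1}}(I-\pi_\tau)$$ as operators on $C^\alpha(\hat{\mathbb C})$, where $I$ is the identity.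
   Context: $\hat{\mathbb C}$, spherical distance $d$; $\mathrm{Rat}$ with $\kappa(f,g)=\sup_zd(f(z),g(z))$; $\langle\Gamma\rangle$, $F(G)$ (equicontinuity set), $J(G)$, $J_{\ker}(G)=\bigcap_{g\in G}g^{-1}(J(G))$, $\mathrm{Min}(G,\hat{\mathbb C})$ (inclusion-minimal non-empty compact $G$-forward-invariant sets). $\Gamma_\tau=\mathrm{supp}\,\tau$, $G_\tau=\langle\Gamma_\tau\rangle$, $S_\tau=\bigcup_{L\in\mathrm{Min}(G_\tau,\hat{\mathbb C})}L$, $M_\tau\varphi(z)=\int\varphi(g(z))d\tau(g)$. $\mathcal U_{f,\tau}(\hat{\mathbb C})$ = non-zero $\varphi\in C(\hat{\mathbb C})$ with $M_\tau\varphi=a\varphi$, $|a|=1$; $\mathcal U_{v,\tau}(\hat{\mathbb C})$ = the set of such $a$; LS = linear span. Known: $C(\hat{\mathbb C})=\mathrm{LS}(\mathcal U_{f,\tau}(\hat{\mathbb C}))\oplus\{\varphi:\|M^n_\tau\varphi\|_\infty\to0\}$, first summand finite-dimensional; $\pi_\tau$ = projection onto it. $C^\alpha(\hat{\mathbb C})$ = $\alpha$-Hölder functions with $\|\varphi\|_\alpha=\sup|\varphi|+\sup_{x\ne y}|\varphi(x)-\varphi(y)|/d(x,y)^\alpha$. *)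

(* Defs.v *)
From HB Require Import structures.
From mathcomp Require Import all_boot all_order all_algebra.
From mathcomp Require Import all_classical all_reals all_analysis.
From mathcomp Require Import complex.
Set Implicit Arguments. Unset Strict Implicit. Unset Printing Implicit Defensive.
Import Order.TTheory GRing.Theory Num.Theory.
Import numFieldNormedType.Exports.
Local Open Scope classical_set_scope.
Local Open Scope ring_scope.

Section Defs.
Variable R : realType.
Local Notation C := R[i].

Definition cnorm (z : C) : R := Num.sqrt (complex.Re z ^+ 2 + complex.Im z ^+ 2).

(* ---------- The Riemann sphere  \hat C = C u {oo}  (None = oo) ---------- *)
Definition sphere := option C.

Definition stereo (z : sphere) : R * R * R :=
  match z with
  | None => (0, 0, 1)
  | Some w => let n := cnorm w ^+ 2 in
      ((2 * complex.Re w) / (n + 1), (2 * complex.Im w) / (n + 1), (n - 1) / (n + 1))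
  end.

Definition sdist (z w : sphere) : R :=
  let: (a1, a2, a3) := stereo z in let: (b1, b2, b3) := stereo w in
  acos (a1 * b1 + a2 * b2 + a3 * b3).

Definition mopen {T} (d : T -> T -> R) (A : set T) :=
  forall x, A x -> exists2 r : R, 0 < r & forall y, d x y < r -> A y.

Definition mcompact {T} (d : T -> T -> R) (K : set T) :=
  forall (I : Type) (U : I -> set T), (forall i, mopen d (U i)) ->
  K `<=` \bigcup_i U i ->
  exists2 F : set I, finite_set F & K `<=` \bigcup_(i in F) U i.

Definition rat_of (p q : {poly C}) (z : sphere) : sphere :=
  match z with
  | Some w => if q.[w] == 0 then None else Some (p.[w] / q.[w])
  | None => if (size q < size p)%N then None
            else if size p == size q then Some (lead_coef p / lead_coef q)
            else Some 0
  end.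

Definition is_rat (g : sphere -> sphere) :=
  exists p q : {poly C}, [/\ q != 0, coprimep p q,
    (1 < maxn (size p) (size q))%N & g = rat_of p q].

Record Rat := MkRat { ratf :> sphere -> sphere; ratP : is_rat ratf }.

Lemma is_rat_id : is_rat id.
Proof.
exists 'X, 1; split.
- exact: oner_neq0.
- by rewrite coprimep1.
- by rewrite size_polyX size_poly1.
- apply: funext => -[w|] /=.
  + by rewrite hornerC oner_eq0 hornerX divr1.
  + by rewrite size_polyX size_poly1.
Qed.

HB.instance Definition _ := gen_eqMixin Rat.
HB.instance Definition _ := gen_choiceMixin Rat.
HB.instance Definition _ := isPointed.Build Rat (MkRat is_rat_id).

Definition kappa (f g : Rat) : R := sup [set sdist (f z) (g z) | z in [set: sphere]].

Definition RatM := g_sigma_algebraType (mopen kappa).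

Definition supp (tau : probability RatM R) : set Rat :=
  [set f | forall r : R, 0 < r -> (0 < tau [set g : RatM | (kappa f g < r)%R])%E].

Definition gen_semigroup (Gam : set Rat) : set (sphere -> sphere) :=
  [set h | exists (g0 : Rat) (s : seq Rat), [/\ Gam g0,
     (forall g, g \in s -> Gam g) &
     h = foldr (fun (g : Rat) acc => (g : sphere -> sphere) \o acc) (g0 : sphere -> sphere) s]].

Definition Fatou (G : set (sphere -> sphere)) : set sphere :=
  [set z | exists2 r : R, 0 < r & forall w, sdist z w < r ->
     forall e : R, 0 < e -> exists2 del : R, 0 < del &
       forall g, G g -> forall y, sdist w y < del -> sdist (g w) (g y) < e].
Definition Julia G := ~` Fatou G.
Definition Jker (G : set (sphere -> sphere)) : set sphere :=
  [set z | forall g, G g -> Julia G (g z)].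

Definition forward_inv (G : set (sphere -> sphere)) (K : set sphere) :=
  forall g, G g -> g @` K `<=` K.

Definition minimal_set (G : set (sphere -> sphere)) (L : set sphere) :=
  [/\ L !=set0, mcompact sdist L, forward_inv G L &
   forall K, K !=set0 -> mcompact sdist K -> forward_inv G K -> K `<=` L -> K = L].

Definition Gtau (tau : probability RatM R) := gen_semigroup (supp tau).
Definition Stau (tau : probability RatM R) : set sphere :=
  \bigcup_(L in minimal_set (Gtau tau)) L.

Definition compact_supp (tau : probability RatM R) := mcompact kappa (supp tau).

Definition ccont (phi : sphere -> C) :=
  forall z (e : R), 0 < e -> exists2 del : R, 0 < del &
    forall w, sdist z w < del -> cnorm (phi w - phi z) < e.

Definition supnorm (phi : sphere -> C) : R := sup [set cnorm (phi z) | z in [set: sphere]].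

Definition cint (tau : probability RatM R) (f : RatM -> C) : C :=
  Complex (Rintegral tau setT (fun g => complex.Re (f g))) (Rintegral tau setT (fun g => complex.Im (f g))).

Definition Mtau (tau : probability RatM R) (phi : sphere -> C) : sphere -> C :=
  fun z => cint tau (fun g : RatM => phi ((g : Rat) z)).

Definition Mtau_n tau n := iter n (Mtau tau).

Definition Uf (tau : probability RatM R) : set (sphere -> C) :=
  [set phi | [/\ ccont phi, phi <> (fun=> 0) &
     exists a : C, cnorm a = 1 /\ Mtau tau phi = (fun z => a * phi z)]].

Definition Uv (tau : probability RatM R) : set C :=
  [set a | cnorm a = 1 /\ exists phi, [/\ ccont phi, phi <> (fun=> 0) &
     Mtau tau phi = (fun z => a * phi z)]].

Definition LS (A : set (sphere -> C)) : set (sphere -> C) :=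
  [set psi | exists (n : nat) (c : nat -> C) (f : nat -> sphere -> C),
     (forall i, (i < n)%N -> A (f i)) /\ psi = (fun z => \sum_(i < n) c i * f i z)].

Definition decaying (tau : probability RatM R) : set (sphere -> C) :=
  [set phi | ccont phi /\ (fun n => supnorm (Mtau_n tau n phi)) @ \oo --> (0 : R)].

(* pi is the projection onto LS(U_f) along {phi : ||M^n phi|| -> 0} *)
Definition is_pi_tau (tau : probability RatM R) (pi : (sphere -> C) -> sphere -> C) :=
  forall phi, ccont phi -> LS (Uf tau) (pi phi) /\ decaying tau (fun z => phi z - pi phi z).

Definition holder (alpha : R) (phi : sphere -> C) :=
  exists K : R, forall x y, cnorm (phi x - phi y) <= K * (sdist x y `^ alpha).

Definition hnorm (alpha : R) (phi : sphere -> C) : R :=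
  supnorm phi + sup [set t | exists x y, x <> y /\
                      t = cnorm (phi x - phi y) / (sdist x y `^ alpha)].

Definition resolvent_op (tau : probability RatM R) (alpha : R) (zeta : C)
    (T : (sphere -> C) -> sphere -> C) :=
  [/\ forall phi, holder alpha phi -> holder alpha (T phi),
   forall a b phi psi, holder alpha phi -> holder alpha psi ->
     T (fun z => a * phi z + b * psi z) = (fun z => a * T phi z + b * T psi z),
   exists K : R, forall phi, holder alpha phi -> hnorm alpha (T phi) <= K * hnorm alpha phi,
   forall phi, holder alpha phi -> T (fun z => zeta * phi z - Mtau tau phi z) = phi &
   forall phi, holder alpha phi -> (fun z => zeta * T phi z - Mtau tau (T phi) z) = phi].

Definition spec_alpha (tau : probability RatM R) (alpha : R) : set C :=
  [set zeta | ~ exists T, resolvent_op tau alpha zeta T].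

End Defs.

(* Main.v *)
Require Import Defs.
From HB Require Import structures.
From mathcomp Require Import all_boot all_order all_algebra.
From mathcomp Require Import all_classical all_reals all_analysis.
From mathcomp Require Import complex.
From mathcomp Require Import ring lra.
(** Rational maps are Lipschitz for the spherical metric, and by the Schwarz lemma a
map sending all balls of a fixed radius into hemispheres is Lipschitz with a constant
depending on that radius only; hence near a given map the Lipschitz constants are
bounded, and compactness of the support yields one Lipschitz constant for almost every
map.  So [Mtau] is bounded on the Hoelder space.

The sum LS(U_f) + {decaying functions} is direct, since a trigonometric sum tending to 0
vanishes.  The set U_v is finite: otherwise a convergent series of eigenfunctions with
distinct unimodular eigenvalues would be a continuous function whose projection to
LS(U_f) has only finitely many frequencies, contradicting the Cesaro means.  The product
of the factors [Mtau - a] over the eigenvalues a then annihilates LS(U_f), so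
[zeta - Mtau] has a bounded inverse there, while on the complement the Neumann series
converges geometrically with ratio lambda / |zeta|. *)

Set Implicit Arguments. Unset Strict Implicit. Unset Printing Implicit Defensive.
Import Order.TTheory GRing.Theory Num.Theory.
Import numFieldNormedType.Exports.
Local Open Scope classical_set_scope.
Local Open Scope ring_scope.
Local Notation "x %:C" := (real_complex _ x) : ring_scope.

(** Two obstacles shape the development. The assumed decay concerns the range of I - pi only, so
    boundedness of [Mtau] has to come from the maps themselves; and closeness in [kappa] controls
    values, not derivatives. Holomorphy bridges this gap, through a maximum principle for quotients
    of polynomials. Passing from the support to almost every map takes a countability argument,
    supplied by the total boundedness, for each m, of the set of m-Lipschitz rational maps. The
    second obstacle is that elements of [LS (Uf tau)] come with arbitrary representations as sums of
    eigenfunctions, without basis or dimension bound. Coordinates therefore give no estimates, and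
    the frequencies in a representation may repeat; the lemmas on exponential sums are stated so as
    to allow this. Likewise the projection is given only through the decomposition that it produces,
    so linearity of the resolvent is drawn from the injectivity of zeta - [Mtau]. *)

Section ComplexModulus.
Variable R : realType.
Implicit Types z w : R[i].

Lemma cnormE z : `|z| = (cnorm z)%:C.
Proof. by rewrite normc_def. Qed.

Lemma cnorm_ge0 z : 0 <= cnorm z. Proof. exact: sqrtr_ge0. Qed.
#[local] Hint Extern 0 (is_true (@Order.le _ _ _ (cnorm _))) => apply: cnorm_ge0 : core.

Lemma cnorm_sqr z : cnorm z ^+ 2 = complex.Re z ^+ 2 + complex.Im z ^+ 2.
Proof. by rewrite sqr_sqrtr // addr_ge0 // sqr_ge0. Qed.

Lemma cnormM z w : cnorm (z * w) = cnorm z * cnorm w.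
Proof. by apply: (@complexI R); rewrite -cnormE normrM !cnormE rmorphM. Qed.

Lemma cnorm0 : cnorm (0 : R[i]) = 0.
Proof. by apply: (@complexI R); rewrite -cnormE normr0. Qed.

Lemma cnorm1 : cnorm (1 : R[i]) = 1.
Proof. by apply: (@complexI R); rewrite -cnormE normr1. Qed.

Lemma cnormX z n : cnorm (z ^+ n) = cnorm z ^+ n.
Proof. by apply: (@complexI R); rewrite -cnormE normrX cnormE rmorphXn. Qed.

Lemma cnormV z : cnorm z^-1 = (cnorm z)^-1.
Proof. by apply: (@complexI R); rewrite -cnormE normfV cnormE fmorphV. Qed.

Lemma cnormN z : cnorm (- z) = cnorm z.
Proof. by apply: (@complexI R); rewrite -!cnormE normrN. Qed.

Lemma cnormB z w : cnorm (z - w) = cnorm (w - z).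
Proof. by rewrite -cnormN opprB. Qed.

Lemma cnorm_real (r : R) : cnorm r%:C = `|r|.
Proof. by rewrite /cnorm /= expr0n /= addr0 sqrtr_sqr. Qed.

Lemma cnormD z w : cnorm (z + w) <= cnorm z + cnorm w.
Proof. by rewrite -lecR rmorphD /= -!cnormE; apply: ler_normD. Qed.

Lemma cnorm_eq0 z : (cnorm z == 0) = (z == 0).
Proof. by rewrite -(inj_eq (@complexI R)) -cnormE normr_eq0. Qed.

Lemma cnorm_gt0 z : (0 < cnorm z) = (z != 0).
Proof. by rewrite lt_def cnorm_ge0 cnorm_eq0 andbT. Qed.

Lemma cnorm_sum I (r : seq I) (P : pred I) (F : I -> R[i]) :
  cnorm (\sum_(i <- r | P i) F i) <= \sum_(i <- r | P i) cnorm (F i).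
Proof.
elim/big_rec2: _ => [|i y x _ H]; first by rewrite cnorm0.
by apply: (le_trans (cnormD _ _)); rewrite lerD2l.
Qed.

Lemma cnorm_Re z : `|complex.Re z| <= cnorm z.
Proof. by rewrite -sqrtr_sqr ler_wsqrtr // lerDl sqr_ge0. Qed.

Lemma cnorm_Im z : `|complex.Im z| <= cnorm z.
Proof. by rewrite -sqrtr_sqr ler_wsqrtr // lerDr sqr_ge0. Qed.

Lemma cnorm_ReIm z : cnorm z <= `|complex.Re z| + `|complex.Im z|.
Proof.
rewrite -[leRHS]ger0_norm ?addr_ge0 // -sqrtr_sqr ler_wsqrtr // sqrrD.
by rewrite !real_normK ?num_real // lerD2r lerDl mulrn_wge0 // mulr_ge0.
Qed.

Lemma lerB_cnorm z w : cnorm z - cnorm w <= cnorm (z - w).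
Proof. by rewrite lerBlDr -{1}(subrK w z) cnormD. Qed.

Lemma lerB_cnormD z w : cnorm z - cnorm w <= cnorm (z + w).
Proof. by rewrite -(opprK w) cnormN; apply: lerB_cnorm. Qed.

End ComplexModulus.
#[local] Hint Extern 0 (is_true (@Order.le _ _ _ (cnorm _))) => apply: cnorm_ge0 : core.

(** * The spherical distance as a metric *)

Section SphereMetric.
Variable R : realType.
Implicit Types x y : sphere R.

(* The squared chordal distance, normalised so that its maximum is 1. *)
Definition chord2 x y : R :=
  match x, y with
  | Some z, Some w => cnorm (z - w) ^+ 2 / ((1 + cnorm z ^+ 2) * (1 + cnorm w ^+ 2))
  | Some z, None | None, Some z => (1 + cnorm z ^+ 2)^-1
  | None, None => 0
  end.

Let cn1 (z : R[i]) : 0 < 1 + cnorm z ^+ 2.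
Proof. by rewrite ltr_pwDl // sqr_ge0. Qed.

Lemma chord2_ge0 x y : 0 <= chord2 x y.
Proof.
case: x => [z|]; case: y => [w|] //=; rewrite ?invr_ge0 ?(ltW (cn1 _)) //.
by apply: divr_ge0; [apply: sqr_ge0|apply: mulr_ge0; apply: ltW].
Qed.

Lemma chord2_le1 x y : chord2 x y <= 1.
Proof.
case: x => [z|]; case: y => [w|] //=; rewrite ?invf_le1 ?lerDl ?sqr_ge0 //.
rewrite ler_pdivrMr ?mulr_gt0 // mul1r !cnorm_sqr.
case: z w => [a b] [c d] /=; rewrite -subr_ge0.
rewrite [leRHS](_ : _ = (1 + a * c + b * d) ^+ 2 + (a * d - b * c) ^+ 2); last by ring.
by rewrite addr_ge0 // sqr_ge0.
Qed.

Lemma chord2C x y : chord2 x y = chord2 y x.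
Proof. by case: x => [z|]; case: y => [w|] //=; rewrite cnormB [in RHS]mulrC mulrC (mulrC (1 + _)). Qed.

Lemma chord2_eq0 x y : chord2 x y = 0 -> x = y.
Proof.
case: x => [z|]; case: y => [w|] //=.
- move/eqP; rewrite mulf_eq0 invr_eq0 (mulf_eq0 (1 + _)).
  rewrite (gt_eqF (cn1 z)) (gt_eqF (cn1 w)) /= orbF.
  by rewrite expf_eq0 /= cnorm_eq0 subr_eq0 => /eqP ->.
- by move/eqP; rewrite invr_eq0 (gt_eqF (cn1 _)).
- by move/eqP; rewrite invr_eq0 (gt_eqF (cn1 _)).
Qed.

Lemma chord2xx x : chord2 x x = 0.
Proof. by case: x => [z|] //=; rewrite subrr cnorm0 expr0n mul0r. Qed.

Lemma stereo_dot x y : let: (a1, a2, a3) := stereo x in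
  let: (b1, b2, b3) := stereo y in
  a1 * b1 + a2 * b2 + a3 * b3 = 1 - 2 * chord2 x y.
Proof.
case: x => [z|]; case: y => [w|] /=; last by ring.
- move: (cn1 z) (cn1 w); rewrite !cnorm_sqr; case: z w => [a b] [c d] /=.
  move=> /lt0r_neq0 h1 /lt0r_neq0 h2; field.
  by rewrite h1 h2.
- move: (cn1 z); rewrite !cnorm_sqr; case: z => [a b] /=.
  by move=> /lt0r_neq0 h1; field.
- move: (cn1 w); rewrite !cnorm_sqr; case: w => [a b] /=.
  by move=> /lt0r_neq0 h1; field.
Qed.

Lemma sdistE x y : sdist x y = acos (1 - 2 * chord2 x y).
Proof.
have := stereo_dot x y; rewrite /sdist.
by case: (stereo x) => [[a1 a2] a3]; case: (stereo y) => [[b1 b2] b3] ->.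
Qed.

Lemma chord2_itv x y : -1 <= 1 - 2 * chord2 x y <= 1.
Proof. by have := chord2_ge0 x y; have := chord2_le1 x y; lra. Qed.

Lemma sdist_ge0 x y : 0 <= sdist x y.
Proof. by rewrite sdistE acos_ge0 // chord2_itv. Qed.
Lemma sdist_lepi x y : sdist x y <= pi.
Proof. by rewrite sdistE acos_lepi // chord2_itv. Qed.
Lemma sdistC x y : sdist x y = sdist y x.
Proof. by rewrite !sdistE chord2C. Qed.
Lemma sdistxx x : sdist x x = 0.
Proof. by rewrite sdistE chord2xx mulr0 subr0 acos1. Qed.
Lemma cos_sdist x y : cos (sdist x y) = 1 - 2 * chord2 x y.
Proof. by rewrite sdistE acosK // in_itv /= chord2_itv. Qed.
Lemma sdist_eq0 x y : sdist x y = 0 -> x = y.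
Proof.
by move=> h; apply: chord2_eq0; have := cos_sdist x y; rewrite h cos0; lra.
Qed.
Lemma sdist_gt0 x y : x <> y -> 0 < sdist x y.
Proof. by move=> xy; rewrite lt_def sdist_ge0 andbT; apply/eqP => /sdist_eq0. Qed.

Lemma stereo_norm x : let: (a1, a2, a3) := stereo x in a1 ^+ 2 + a2 ^+ 2 + a3 ^+ 2 = 1.
Proof.
have := stereo_dot x x; case: (stereo x) => [[a b] c].
by rewrite chord2xx mulr0 subr0 !expr2.
Qed.

(** The Gram determinant of three unit vectors is a square, hence non-negative. This says that cos
    d(x,z) differs from cos d(x,y) cos d(y,z) by at most sin d(x,y) sin d(y,z), so that cos d(x,z)
    is at least the cosine of d(x,y) + d(y,z). *)
Lemma sdist_triangle y x z : sdist x z <= sdist x y + sdist y z.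
Proof.
have [pi_le|lt_pi] := leP pi (sdist x y + sdist y z).
  exact: le_trans (sdist_lepi _ _) pi_le.
rewrite leNgt; apply/negP => h.
have := @ltr_cos R (sdist x y + sdist y z) (sdist x z).
rewrite !in_itv /= sdist_ge0 sdist_lepi addr_ge0 ?sdist_ge0 // (ltW lt_pi) => /(_ isT isT).
rewrite h => /idP; apply/negP; rewrite -leNgt cosD.
have H : (cos (sdist x z) - cos (sdist x y) * cos (sdist y z)) ^+ 2 <=
         (sin (sdist x y) * sin (sdist y z)) ^+ 2.
  rewrite exprMn !sin2cos2 !cos_sdist.
  have := stereo_dot x y; have := stereo_dot y z; have := stereo_dot x z.
  have := stereo_norm x; have := stereo_norm y; have := stereo_norm z.
  case: (stereo x) => [[a1 a2] a3]; case: (stereo y) => [[b1 b2] b3].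
  case: (stereo z) => [[c1 c2] c3] nc nb na <- <- <-.
  have gram := sqr_ge0 (a1 * (b2 * c3 - b3 * c2) - a2 * (b1 * c3 - b3 * c1)
    + a3 * (b1 * c2 - b2 * c1)).
  pose xx := a1 ^+ 2 + a2 ^+ 2 + a3 ^+ 2; pose yy := b1 ^+ 2 + b2 ^+ 2 + b3 ^+ 2.
  pose zz := c1 ^+ 2 + c2 ^+ 2 + c3 ^+ 2.
  pose xy := a1 * b1 + a2 * b2 + a3 * b3; pose yz := b1 * c1 + b2 * c2 + b3 * c3.
  pose xz := a1 * c1 + a2 * c2 + a3 * c3.
  have E : (a1 * (b2 * c3 - b3 * c2) - a2 * (b1 * c3 - b3 * c1)
    + a3 * (b1 * c2 - b2 * c1)) ^+ 2 = xx * yy * zz + 2 * xy * yz * xz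
       - xx * yz ^+ 2 - yy * xz ^+ 2 - zz * xy ^+ 2.
    by rewrite /xx /yy /zz /xy /yz /xz; ring.
  rewrite -/xy -/yz -/xz.
  rewrite E /xx /yy /zz na nb nc in gram.
  rewrite -subr_ge0; move: gram; congr (0 <= _); ring.
have s0 : 0 <= sin (sdist x y) * sin (sdist y z).
  by rewrite mulr_ge0 // sin_ge0_pi // sdist_ge0 sdist_lepi.
move: H s0; set A := cos (sdist x z); set B := cos _ * cos _; set D := sin _ * sin _.
by move=> H s0; rewrite leNgt; apply/negP => h2; nra.
Qed.

End SphereMetric.

(** * Chordal against spherical distance, and homogeneous coordinates *)

Section SphereChord.
Variable R : realType.
Implicit Types x y : sphere R.

(** The mean value theorem gives sin t = t cos c with cos c >= cos t, which settles the case cos t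
    >= 1/4. Otherwise sin t exceeds 1/2, whereas t / 4 <= 1/2 because pi / 2 <= 2. *)
Lemma sin_bounds (t : R) : 0 <= t <= pi / 2 -> t / 4 <= sin t <= t.
Proof.
move=> /andP[]; rewrite le_eqVlt => /predU1P[<- _|t0 tpi].
  by rewrite sin0 mul0r lexx.
have pi2 : pi / 2 <= 2 :> R by have [/andP[]] := @pihalf_02_cos_pihalf R.
have [c] := @MVT R sin cos 0 t t0 (fun s _ => is_derive_sin s)
  (continuous_subspaceT (@continuous_sin R)).
rewrite in_itv /= sin0 !subr0 => /andP[c0 ct] E.
have pi0 := @pi_gt0 R.
have cpi : cos t <= cos c.
  apply: ltW; rewrite ltr_cos // in_itv /= ltW //; first by lra.
  by apply: (le_trans tpi); lra.
have ct0 : 0 <= cos t by apply: cos_ge0_pihalf; rewrite tpi andbT; lra.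
have st0 : 0 <= sin t by apply: sin_ge0_pi; lra.
apply/andP; split; last by rewrite E ler_piMl ?(ltW t0) // cos_le1.
have [h|h] := leP (4^-1) (cos t).
  by rewrite E mulrC ler_wpM2r ?(ltW t0) //; apply: le_trans cpi.
have := sin2cos2 t; nra.
Qed.

Lemma chord2_sin x y : chord2 x y = sin (sdist x y / 2) ^+ 2.
Proof.
have := cos_sdist x y; rewrite -[X in cos X](@divfK _ 2) ?pnatr_eq0 //.
rewrite mulr_natr cos_mulr2n sin2cos2; lra.
Qed.

Lemma chord2_le_sdist x y : chord2 x y <= sdist x y ^+ 2.
Proof.
rewrite chord2_sin; have d0 := sdist_ge0 x y; have dpi := sdist_lepi x y.
have /andP[h1 h2] : sdist x y / 2 / 4 <= sin (sdist x y / 2) <= sdist x y / 2.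
  by apply: sin_bounds; lra.
rewrite ler_sqr ?nnegrE; lra.
Qed.

Lemma sdist_le_chord2 x y : sdist x y ^+ 2 <= 64 * chord2 x y.
Proof.
rewrite chord2_sin; have d0 := sdist_ge0 x y; have dpi := sdist_lepi x y.
have /andP[h1 h2] : sdist x y / 2 / 4 <= sin (sdist x y / 2) <= sdist x y / 2.
  by apply: sin_bounds; lra.
rewrite (_ : 64 * _ = (8 * sin (sdist x y / 2)) ^+ 2); last by ring.
rewrite ler_sqr ?nnegrE; lra.
Qed.

Lemma sdist_pihalf x y : (sdist x y <= pi / 2) = (chord2 x y <= 2^-1).
Proof.
have pi0 := @pi_gt0 R.
have := cos_sdist x y => E.
have d0 := sdist_ge0 x y; have dpi := sdist_lepi x y.
have p2 : (pi / 2 : R) \in `[0, pi]%R by rewrite in_itv /=; lra.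
have d2 : sdist x y \in `[0, pi]%R by rewrite in_itv /= d0.
have := ltr_cos p2 d2; rewrite cos_pihalf E => H.
by rewrite leNgt -H -leNgt; apply/idP/idP; lra.
Qed.

Lemma chord2_stereo x y : let: (a1, a2, a3) := stereo x in
  let: (b1, b2, b3) := stereo y in
  4 * chord2 x y = (a1 - b1) ^+ 2 + (a2 - b2) ^+ 2 + (a3 - b3) ^+ 2.
Proof.
have := stereo_dot x y; have := stereo_norm x; have := stereo_norm y.
case: (stereo x) => [[a1 a2] a3]; case: (stereo y) => [[b1 b2] b3] /=.
by rewrite !sqrrB; lra.
Qed.

(* The point of the Riemann sphere with homogeneous coordinates [a : b]. *)
Definition hpoint (a b : R[i]) : sphere R := if b == 0 then None else Some (a / b).

Definition hnorm2 (a b : R[i]) : R := cnorm a ^+ 2 + cnorm b ^+ 2.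

Lemma hnorm2_gt0 a b : (a != 0) || (b != 0) -> 0 < hnorm2 a b.
Proof.
rewrite -!cnorm_gt0 /hnorm2 => /orP[h|h].
  by rewrite ltr_pwDl ?exprn_gt0 // sqr_ge0.
by rewrite ltr_pwDr ?exprn_gt0 // sqr_ge0.
Qed.

(** The right-hand side is invariant under scaling of either pair of coordinates, so later estimates
    may choose representatives freely and need no separate treatment of infinity. *)
Lemma chord2_hpoint (a b c d : R[i]) : (a != 0) || (b != 0) -> (c != 0) || (d != 0) ->
  chord2 (hpoint a b) (hpoint c d) =
  cnorm (a * d - b * c) ^+ 2 / (hnorm2 a b * hnorm2 c d).
Proof.
move=> /[dup] ab0 /hnorm2_gt0 + /[dup] cd0 /hnorm2_gt0; rewrite /hnorm2 /hpoint.
have [b0|b0] := eqVneq b 0; have [d0|d0] := eqVneq d 0;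
  rewrite ?b0 ?d0 ?eqxx ?orbF ?orbT /= in ab0 cd0 *.
- by rewrite mulr0 mul0r subrr cnorm0 expr0n mul0r.
- rewrite mul0r subr0 cnorm0 expr0n addr0 !cnormM cnormV.
  move: ab0 d0; rewrite -!cnorm_gt0 => /lt0r_neq0 h1 /lt0r_neq0 h2 _ /lt0r_neq0 h3.
  by field; rewrite ?h1 ?h2 ?h3 //= addrC.
- rewrite mulr0 sub0r cnormN cnorm0 expr0n addr0 !cnormM cnormV.
  move: cd0 b0; rewrite -!cnorm_gt0 => /lt0r_neq0 h1 /lt0r_neq0 h2 /lt0r_neq0 h3 _.
  by field; rewrite ?h1 ?h2 ?h3 //= addrC.
- have -> : a / b - c / d = (a * d - b * c) / (b * d).
    by field; rewrite b0 d0.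
  rewrite !cnormM !cnormV !cnormM.
  move: d0 b0; rewrite -!cnorm_gt0 => /lt0r_neq0 h1 /lt0r_neq0 h2 /lt0r_neq0 h3 /lt0r_neq0 h4.
  by field; rewrite ?h1 ?h2 ?h3 ?h4 //= ?(addrC _ (cnorm a ^+ 2)) ?(addrC _ (cnorm c ^+ 2)) ?h3 ?h4.
Qed.

End SphereChord.

(** * Maximum principle and Schwarz lemma for quotients of polynomials *)

Section MaximumModulus.
Variable R : realType.
Implicit Types (p q : {poly R[i]}) (z w : R[i]) (r : R).

Lemma horner_bound p r : 0 <= r ->
  exists2 B : R, 0 <= B & forall z, cnorm z <= r -> cnorm p.[z] <= B.
Proof.
move=> r0; exists (\sum_(i < size p) cnorm p`_i * r ^+ i).
  by apply: sumr_ge0 => i _; rewrite mulr_ge0 // exprn_ge0.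
move=> z zr; rewrite horner_coef; apply: (le_trans (cnorm_sum _ _ _)).
apply: ler_sum => i _; rewrite cnormM cnormX ler_wpM2l //.
by rewrite lerXn2r ?nnegrE.
Qed.

Lemma horner_lipschitz p r : 0 <= r ->
  exists2 B : R, 0 <= B & forall z w, cnorm z <= r -> cnorm w <= r ->
    cnorm (p.[z] - p.[w]) <= B * cnorm (z - w).
Proof.
move=> r0; elim/poly_ind: p => [|p c [B B0 IH]].
  by exists 0 => // z w _ _; rewrite !horner0 subrr cnorm0 mul0r.
have [A A0 HA] := horner_bound p r0.
exists (B * r + A); first by rewrite addr_ge0 // mulr_ge0.
move=> z w zr wr; rewrite !hornerMXaddC.
have -> : p.[z] * z + c - (p.[w] * w + c) = (p.[z] - p.[w]) * z + p.[w] * (z - w).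
  by ring.
apply: (le_trans (cnormD _ _)); rewrite !cnormM mulrDl lerD //.
  by rewrite (mulrAC B); apply: ler_pM => //; exact: IH.
by rewrite ler_wpM2r // HA.
Qed.

Lemma horner_continuous p z (e : R) : 0 < e ->
  exists2 del : R, 0 < del & forall w, cnorm (w - z) < del -> cnorm (p.[w] - p.[z]) < e.
Proof.
move=> e0.
have r0 : 0 <= cnorm z + 1 by rewrite addr_ge0.
have [B B0 HB] := horner_lipschitz p r0.
exists (Num.min 1 (e / (B + 1))); first by rewrite lt_min ltr01 divr_gt0 // ltr_wpDl.
move=> w; rewrite lt_min => /andP[w1 w2].
have wr : cnorm w <= cnorm z + 1.
  by rewrite -[w](subrK z) addrC (le_trans (cnormD _ _)) // lerD2l ltW.
apply: (le_lt_trans (HB _ _ wr _)); first by rewrite lerDl.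
apply: (@le_lt_trans _ _ ((B + 1) * cnorm (w - z))).
  by rewrite ler_wpM2r // lerDl.
by rewrite mulrC -ltr_pdivlMr // ltr_wpDl.
Qed.

Lemma disc_EVT (f : R[i] -> R) r : 0 <= r ->
  (forall z (e : R), 0 < e -> exists2 del : R, 0 < del &
     forall w, cnorm w <= r -> cnorm z <= r -> cnorm (w - z) < del -> `|f w - f z| < e) ->
  exists2 z, cnorm z <= r & forall w, cnorm w <= r -> f w <= f z.
Proof.
move=> r0 fc.
pose g (u : R * R) : R[i] := Complex u.1 u.2.
pose sq : set (R * R) := `[-r, r] `*` `[-r, r].
pose D : set (R * R) := [set u | cnorm (g u) <= r].
have ctsg : continuous (fun u : R * R => u.1 ^+ 2 + u.2 ^+ 2).
  move=> u; apply: cvgD; rewrite /GRing.exp /=; apply: cvgM; (exact: cvg_fst || exact: cvg_snd).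
have DE : D = (fun u : R * R => u.1 ^+ 2 + u.2 ^+ 2) @^-1` `]-oo, r ^+ 2].
  have E u : (cnorm (g u) <= r) = (u.1 ^+ 2 + u.2 ^+ 2 <= r ^+ 2).
    by rewrite -ler_sqr ?nnegrE // cnorm_sqr.
  by apply/seteqP; split => u; rewrite /D /= in_itv /= E.
have closedD : closed D.
  by rewrite DE; apply: preimage_closed => //; exact: interval_closed.
have sqc : compact sq by apply: compact_setX; apply: segment_compact.
have Dsq : D `<=` sq.
  move=> u Du; split; rewrite /= in_itv /= -ler_norml.
    exact: le_trans (cnorm_Re (g u)) Du.
  exact: le_trans (cnorm_Im (g u)) Du.
have Dc : compact D by apply: (subclosed_compact closedD sqc Dsq).
have D0 : D !=set0 by exists (0, 0); rewrite /D /= /g /= -[Complex 0 0]/(0 : R[i]) cnorm0.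
have fD : {within D, continuous (f \o g)}.
  apply/subspace_continuousP => u Du; apply/cvgrPdist_lt => e e0.
  have [del del0 H] := fc (g u) e e0.
  rewrite near_withinE; near=> v => Dv.
  rewrite distrC; apply: H => //.
  apply: (le_lt_trans (cnorm_ReIm _)) => /=.
  have d2 : del = del / 2 + del / 2 by lra.
  rewrite d2; apply: ltrD; near: v.
    have : (fun v : R * R => v.1) @ u --> u.1 by exact: cvg_fst.
    move/cvgrPdist_lt => /(_ (del / 2) (divr_gt0 del0 (ltr0Sn _ _))).
    by apply: filterS => v; rewrite distrC.
  have : (fun v : R * R => v.2) @ u --> u.2 by exact: cvg_snd.
  move/cvgrPdist_lt => /(_ (del / 2) (divr_gt0 del0 (ltr0Sn _ _))).
  by apply: filterS => v; rewrite distrC.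
have [c] := compact_EVT_max D0 Dc fD; rewrite inE => Dc' Hc.
exists (g c) => // w wr.
have := Hc (complex.Re w, complex.Im w); rewrite inE /D /= /g /=.
by case: w wr => a b /= wr; apply.
Unshelve. all: by end_near. Qed.

Lemma quotient_modulus_continuous p q z (e : R) : 0 < e -> q.[z] != 0 ->
  exists2 del : R, 0 < del & forall w, q.[w] != 0 -> cnorm (w - z) < del ->
    `|cnorm p.[w] / cnorm q.[w] - cnorm p.[z] / cnorm q.[z]| < e.
Proof.
move=> e0; rewrite -cnorm_gt0; set m := cnorm q.[z] => m0.
have [d1 d10 H1] := horner_continuous q z (divr_gt0 m0 (ltr0Sn _ 1)).
have e1 : 0 < e * m ^+ 2 / 2 by rewrite divr_gt0 // mulr_gt0 // exprn_gt0.
(* After clearing denominators, the difference of the two moduli is controlled by this polynomial,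
   which vanishes at [z]. *)
have [d2 d20 H2] := horner_continuous (q.[z] *: p - p.[z] *: q) z e1.
exists (Num.min d1 d2); first by rewrite lt_min d10.
move=> w; rewrite -cnorm_gt0 lt_min => qw /andP[/H1 h1 /H2].
rewrite !(hornerD, hornerN, hornerZ) (mulrC q.[z] p.[z]) subrr subr0 => h2.
have qm : m / 2 < cnorm q.[w].
  have := lerB_cnorm q.[z] q.[w]; rewrite cnormB -/m; lra.
have -> : cnorm p.[w] / cnorm q.[w] - cnorm p.[z] / m =
  (cnorm (q.[z] * p.[w]) - cnorm (p.[z] * q.[w])) / (cnorm q.[w] * m).
  by rewrite !cnormM -/m; field; rewrite !gt_eqF.
rewrite normrM normfV (gtr0_norm (mulr_gt0 qw m0)) ltr_pdivrMr ?mulr_gt0 //.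
apply: (@le_lt_trans _ _ (cnorm (q.[z] * p.[w] - p.[z] * q.[w]))).
  by rewrite ler_norml -lerN2 opprK opprB lerB_cnorm cnormB lerB_cnorm.
rewrite -subr_gt0 in qm; have := mulr_gt0 (mulr_gt0 e0 m0) qm; rewrite expr2 in h2; lra.
Qed.

(** If p/q is not constant, p - h q with h = p(z)/q(z) vanishes at z to a finite order k >= 1. Along
    a suitable direction v, p/q then behaves like h (1 + e^k) at distance proportional to e, and its
    modulus exceeds |h|. *)
Lemma local_max_modulus p q z r : 0 < r -> q.[z] != 0 ->
  (forall w, cnorm (w - z) < r -> cnorm p.[w] * cnorm q.[z] <= cnorm p.[z] * cnorm q.[w]) ->
  p.[z] = 0 \/ q.[z] *: p = p.[z] *: q.
Proof.
move=> r0 qz hmax; have [->|pz] := eqVneq p.[z] 0; [by left|right].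
pose h := p.[z] / q.[z]; pose s := p - h *: q.
have sz : s.[z] = 0 by rewrite /s !hornerE /h divfK // subrr.
have [s0|s0] := eqVneq s 0.
  have -> : p = h *: q by apply/eqP; rewrite -subr_eq0 -/s s0.
  by rewrite scalerA hornerZ mulrC.
exfalso.
have [k [s1 rs1 Es]] := multiplicity_XsubC s z.
rewrite s0 /= in rs1.
have k0 : (0 < k)%N.
  rewrite lt0n; apply/eqP => k0; move: rs1; rewrite /root -sz Es k0 expr0 mulr1.
  by rewrite eqxx.
have s1z : s1.[z] != 0 by [].
(* The direction is chosen so that the leading term s1(z) (e v)^k equals e^k p(z), a positive
   multiple of p(z). *)
pose v := k.-root (p.[z] / s1.[z]).
have vk : v ^+ k = p.[z] / s1.[z] by rewrite /v rootCK.
(* The error of replacing s1 by its value at [z]; it vanishes at [z], so that near [z] it is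
   dominated by [q]. *)
pose u := (q.[z] / s1.[z]) *: s1 - q.
have uz : u.[z] = 0 by rewrite /u !hornerE divfK // subrr.
have m0 : 0 < cnorm q.[z] by rewrite cnorm_gt0.
have m4 : 0 < cnorm q.[z] / 4 by rewrite divr_gt0.
have [d1 d10 H1] := horner_continuous q z m4.
have [d2 d20 H2] := horner_continuous u z m4.
pose d := Num.min r (Num.min d1 d2).
have d0 : 0 < d by rewrite !lt_min r0 d10.
pose e := d / (cnorm v + 1).
have v1 : 0 < cnorm v + 1 by rewrite ltr_wpDl.
have e0 : 0 < e by rewrite divr_gt0.
pose t := z + e%:C * v.
have td : cnorm (t - z) < d.
  rewrite /t addrC addKr cnormM cnorm_real gtr0_norm // /e mulrAC ltr_pdivrMr //.
  by rewrite ltr_pM2l // ltrDl.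
have := td; rewrite !lt_min => /and3P[/hmax hm /H1 h1 /H2].
rewrite uz subr0 => h2.
have q1 : cnorm q.[z] / 2 < cnorm q.[t].
  have := lerB_cnorm q.[z] q.[t]; rewrite (cnormB q.[z]); lra.
have Ept : p.[t] = h * ((1 + (e ^+ k)%:C) * q.[t] + (e ^+ k)%:C * u.[t]).
  have -> : p = s + h *: q by rewrite /s subrK.
  have tz : t - z = e%:C * v by rewrite /t addrC addKr.
  rewrite hornerD hornerZ Es hornerM horner_exp hornerXsubC tz exprMn vk.
  rewrite /u !(hornerD, hornerN, hornerZ).
  rewrite rmorphXn /= /h; field; by rewrite qz s1z.
move: hm; rewrite Ept cnormM {1}/h cnormM cnormV mulrAC divfK ?cnorm_eq0 //.
rewrite ler_pM2l ?cnorm_gt0 //; apply/negP; rewrite -ltNge.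
have ek : 0 < e ^+ k by rewrite exprn_gt0.
apply: lt_le_trans (lerB_cnormD _ _); rewrite !cnormM cnorm_real gtr0_norm //.
have -> : cnorm (1 + (e ^+ k)%:C) = 1 + e ^+ k.
  by rewrite -[1]/(1%:C) -rmorphD cnorm_real gtr0_norm // addr_gt0.
nra.
Qed.

(** |p/q| attains its maximum over the closed disc. At an interior maximum either p vanishes or p/q
    is constant, and in the latter case the bound is read off at the boundary point r. *)
Lemma max_modulus p q r c : 0 < r ->
  (forall z, cnorm z <= r -> q.[z] != 0) ->
  (forall z, cnorm z = r -> cnorm p.[z] <= c * cnorm q.[z]) ->
  forall z, cnorm z <= r -> cnorm p.[z] <= c * cnorm q.[z].
Proof.
move=> r0 q0 hb.
have cr : cnorm r%:C = r by rewrite cnorm_real gtr0_norm.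
have qgt z : cnorm z <= r -> 0 < cnorm q.[z] by rewrite cnorm_gt0; apply: q0.
have c0 : 0 <= c.
  have := hb _ cr; have := qgt r%:C; rewrite cr lexx => /(_ isT) h1 h2.
  by rewrite -(pmulr_lge0 _ h1); apply: le_trans h2.
have [z0 z0r hmax] : exists2 z, cnorm z <= r & forall w, cnorm w <= r ->
    cnorm p.[w] / cnorm q.[w] <= cnorm p.[z] / cnorm q.[z].
  apply: (@disc_EVT (fun z => cnorm p.[z] / cnorm q.[z]) r (ltW r0)) => z e e0.
  have [zr|zr] := leP (cnorm z) r; last first.
    by exists 1 => // w _; rewrite leNgt zr.
  have [d d0 H] := quotient_modulus_continuous p e0 (q0 _ zr).
  by exists d => // w wr _; apply: H; exact: q0.
suff bz0 : cnorm p.[z0] <= c * cnorm q.[z0].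
  move=> z zr; rewrite -ler_pdivrMr ?qgt //; apply: (le_trans (hmax _ zr)).
  by rewrite ler_pdivrMr // qgt.
move: z0r; rewrite le_eqVlt => /predU1P[/hb //|z0r].
have [||pz|E] := @local_max_modulus p q z0 (r - cnorm z0) _ (q0 _ (ltW z0r)).
- by rewrite subr_gt0.
- move=> w wz; have wr : cnorm w <= r.
    rewrite -[w](subrK z0); apply: (le_trans (cnormD _ _)); lra.
  have := hmax _ wr; rewrite ler_pdivrMr ?qgt // mulrAC ler_pdivlMr ?qgt //.
  exact: ltW.
- by rewrite pz cnorm0 mulr_ge0.
- have := congr1 (fun s : {poly R[i]} => cnorm s.[r%:C]) E.
  rewrite !hornerE !cnormM => E2.
  have := hb _ cr; have := qgt r%:C; rewrite cr lexx => /(_ isT) h1 h2.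
  rewrite -(ler_pM2r h1) -E2 mulrC -mulrA (mulrC (cnorm q.[z0])) mulrA.
  by rewrite ler_wpM2r.
Qed.

(** Dividing p by X leaves a quotient bounded by 1/r on the circle of radius r, hence on the disc by
    the maximum principle. *)
Lemma schwarz p q r : 0 < r -> p.[0] = 0 ->
  (forall z, cnorm z <= r -> q.[z] != 0 /\ cnorm p.[z] <= cnorm q.[z]) ->
  forall z, cnorm z <= r -> r * cnorm p.[z] <= cnorm z * cnorm q.[z].
Proof.
move=> r0 p0 H z zr.
have [p1 Ep] : exists p1, p = p1 * 'X.
  by have /factor_theorem[p1] : root p 0 by [apply/eqP]; rewrite subr0; exists p1.
have := @max_modulus p1 q r r^-1 r0 (fun w wr => (H w wr).1).
move=> /(_ _ _ zr) h; rewrite Ep hornerM hornerX cnormM mulrA mulrC ler_wpM2l //.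
rewrite -ler_pdivlMl //; apply: h => w wr.
have /H[_] : cnorm w <= r by rewrite wr.
by rewrite Ep hornerM hornerX cnormM wr ler_pdivlMl // mulrC.
Qed.

End MaximumModulus.

(** * Lipschitz estimates for rational maps in homogeneous coordinates *)

Section RationalMaps.
Variable R : realType.
Implicit Types (p q : {poly R[i]}) (a b c e w t z : R[i]) (x y : sphere R).

Definition homog (d : nat) p a b : R[i] := \sum_(i < d.+1) p`_i * a ^+ i * b ^+ (d - i).

Lemma homogE d p a b : (size p <= d.+1)%N -> b != 0 -> homog d p a b = b ^+ d * p.[a / b].
Proof.
move=> sp b0; rewrite (horner_coef_wide _ sp) mulr_sumr; apply: eq_bigr => i _.
rewrite -[in b ^+ d](@subnK i d) ?exprD -1?ltnS // expr_div_n.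
by field; rewrite expf_neq0.
Qed.

Lemma homog0 d p a : homog d p a 0 = p`_d * a ^+ d.
Proof.
rewrite /homog big_ord_recr /= subnn expr0 mulr1 big1 ?add0r // => i _.
by rewrite expr0n subn_eq0 leqNgt ltn_ord mulr0.
Qed.

Definition rdeg p q := (maxn (size p) (size q)).-1.

Section OneMap.
Variables p q : {poly R[i]}.
Hypotheses (q0 : q != 0) (pq : coprimep p q) (deg1 : (1 < maxn (size p) (size q))%N).
Let d := rdeg p q.

Let sizep : (size p <= d.+1)%N.
Proof. by rewrite /d /rdeg prednK ?leq_maxl // (leq_trans _ deg1). Qed.
Let sizeq : (size q <= d.+1)%N.
Proof. by rewrite /d /rdeg prednK ?leq_maxr // (leq_trans _ deg1). Qed.

Let lead_neq0 : (p`_d != 0) || (q`_d != 0).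
Proof.
rewrite /d /rdeg; case: (leqP (size p) (size q)) => h.
  by rewrite (_ : q`_(size q).-1 = lead_coef q) // lead_coef_eq0 q0 orbT.
rewrite (_ : p`_(size p).-1 = lead_coef p) // lead_coef_eq0.
by rewrite -size_poly_eq0 -lt0n (leq_ltn_trans _ h).
Qed.

Lemma homog_neq0 a b : (a != 0) || (b != 0) ->
  (homog d p a b != 0) || (homog d q a b != 0).
Proof.
have [->|b0 _] := eqVneq b 0.
  by rewrite orbF !homog0 !mulf_eq0 !negb_or expf_eq0 => a0; rewrite (negbTE a0) andbF !andbT.
rewrite !homogE // !mulf_eq0 expf_eq0 (negbTE b0) andbF /=.
by case: eqP => //= pz; apply: (coprimep_root pq); exact/eqP.
Qed.

Lemma rat_of_hpoint a b : (a != 0) || (b != 0) ->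
  rat_of p q (hpoint a b) = hpoint (homog d p a b) (homog d q a b).
Proof.
rewrite {1}/hpoint; have [->|b0 _] := eqVneq b 0 => /=.
  rewrite orbF !homog0 => a0; rewrite /hpoint mulf_eq0 expf_eq0 (negbTE a0) andbF orbF.
  have ad : a ^+ d != 0 by rewrite expf_neq0.
  rewrite -mulf_div divff // mulr1; move: lead_neq0.
  rewrite /d /rdeg; case: (ltngtP (size q) (size p)) => [h|h|h] /=.
  - by rewrite (nth_default 0 (s := q)) ?eqxx // -ltnS prednK // (leq_ltn_trans _ h).
  - rewrite (nth_default 0 (s := p)); last by rewrite -ltnS prednK // (leq_ltn_trans _ h).
    by rewrite eqxx /= mul0r => /negbTE ->.
  - rewrite -[q`__]/(lead_coef q) lead_coef_eq0 (negbTE q0) => _.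
    by rewrite /lead_coef h.
rewrite !homogE // /hpoint mulf_eq0 expf_eq0 (negbTE b0) andbF /=.
by rewrite -mulf_div divff ?mul1r // expf_neq0.
Qed.

End OneMap.

(** A Bezout relation u p + v q = 1, with u and v bounded on the disc, keeps p and q from being
    small simultaneously. *)
Lemma coprime_lower_bound p q : coprimep p q ->
  exists2 m : R, 0 < m & forall z, cnorm z <= 1 -> m <= hnorm2 p.[z] q.[z].
Proof.
move=> /Bezout_eq1_coprimepP[[u v] /= E].
have [A A0 HA] := horner_bound u (@ler01 R).
have [B B0 HB] := horner_bound v (@ler01 R).
pose K := A + B + 1; have K0 : 0 < K by rewrite /K; lra.
exists (K ^- 2 / 2); first by rewrite divr_gt0 // invr_gt0 exprn_gt0.
move=> z z1; have := congr1 (fun s : {poly R[i]} => cnorm s.[z]) E.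
rewrite hornerD !hornerM hornerC cnorm1 => Ez.
have := cnormD (u.[z] * p.[z]) (v.[z] * q.[z]); rewrite Ez !cnormM => h.
rewrite /hnorm2; set P := cnorm p.[z] in h *; set Q := cnorm q.[z] in h *.
have P0 : 0 <= P by exact: cnorm_ge0.
have Q0 : 0 <= Q by exact: cnorm_ge0.
have h1 : 1 <= K * (P + Q).
  apply: (le_trans h); have := HA _ z1; have := HB _ z1; rewrite /K => hB hA.
  by rewrite mulrDr lerD // ler_wpM2r //; lra.
rewrite ler_pdivrMr // -[X in X <= _]mulr1 ler_pdivrMl ?exprn_gt0 //.
have h2 : 1 <= (K * (P + Q)) ^+ 2 by rewrite expr_ge1 // (le_trans _ h1).
apply: (le_trans h2); rewrite exprMn ler_wpM2l ?sqr_ge0 //.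
by have := sqr_ge0 (P - Q); nra.
Qed.

(** Such representatives cover the two standard charts by closed unit discs, and their [hnorm2] lies
    between 1 and 2. *)
Definition unit_rep a b := [/\ cnorm a <= 1, cnorm b <= 1 & (a = 1) \/ (b = 1)].

Lemma unit_rep_ex x : exists a b, unit_rep a b /\ x = hpoint a b.
Proof.
case: x => [z|]; last first.
  by exists 1, 0; rewrite /unit_rep /hpoint eqxx cnorm1 cnorm0; split => //; split=> //; left.
have [z1|z1] := leP (cnorm z) 1.
  exists z, 1; rewrite /unit_rep /hpoint oner_eq0 divr1 cnorm1; split=> //; split=> //; by right.
have z0 : z != 0 by rewrite -cnorm_gt0; lra.
exists 1, z^-1; rewrite /unit_rep /hpoint invr_eq0 (negbTE z0) invrK mul1r; split=> //.
split; [by rewrite cnorm1| |by left].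
by rewrite cnormV invf_le1 ?(ltW z1) //; lra.
Qed.

Lemma unit_rep_neq0 a b : unit_rep a b -> (a != 0) || (b != 0).
Proof. by case=> _ _ [] ->; rewrite oner_eq0 ?orbT. Qed.

Lemma unit_rep_hnorm2 a b : unit_rep a b -> hnorm2 a b <= 2.
Proof.
case=> a1 b1 _; rewrite /hnorm2 (_ : 2 = 1 + 1) // lerD // expr_le1 //.
Qed.

Lemma cnorm_subX k z w : cnorm z <= 1 -> cnorm w <= 1 ->
  cnorm (z ^+ k - w ^+ k) <= k%:R * cnorm (z - w).
Proof.
move=> z1 w1; elim: k => [|k IH]; first by rewrite !expr0 subrr cnorm0 mul0r.
have -> : z ^+ k.+1 - w ^+ k.+1 = z * (z ^+ k - w ^+ k) + w ^+ k * (z - w).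
  by rewrite !exprS; ring.
apply: (le_trans (cnormD _ _)); rewrite !cnormM cnormX -natr1 mulrDl mul1r lerD //.
  by apply: le_trans IH; rewrite ler_piMl.
by rewrite ler_piMl // exprn_ile1.
Qed.

(** After extraction of the common monomial there remains (ae)^m - (bc)^m with m = i - j, a multiple
    of ae - bc whose cofactor is at most m on the unit polydisc. *)
Lemma monomial_wedge d (i j : nat) a b c e : (i <= d)%N -> (j <= d)%N ->
  cnorm a <= 1 -> cnorm b <= 1 -> cnorm c <= 1 -> cnorm e <= 1 ->
  cnorm (a ^+ i * b ^+ (d - i) * (c ^+ j * e ^+ (d - j))
       - a ^+ j * b ^+ (d - j) * (c ^+ i * e ^+ (d - i))) <= d%:R * cnorm (a * e - b * c).
Proof.
move=> id jd a1 b1 c1 e1; wlog ji : i j id jd / (j <= i)%N.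
  by move=> H; case/orP: (leq_total j i) => ij; [|rewrite cnormB]; apply: H.
have -> : a ^+ i * b ^+ (d - i) * (c ^+ j * e ^+ (d - j))
       - a ^+ j * b ^+ (d - j) * (c ^+ i * e ^+ (d - i)) =
   ((a * c) ^+ j * (b * e) ^+ (d - i)) * ((a * e) ^+ (i - j) - (b * c) ^+ (i - j)).
  have -> : (d - j = (d - i) + (i - j))%N by rewrite addnBA // subnK.
  rewrite -[in a ^+ i](subnK ji) -[in c ^+ i](subnK ji) !exprD !exprMn; ring.
rewrite cnormM; apply: (@le_trans _ _ (1 * ((i - j)%N%:R * cnorm (a * e - b * c)))).
  apply: ler_pM => //; last by apply: cnorm_subX; rewrite cnormM mulr_ile1.
  rewrite cnormM !cnormX mulr_ile1 ?exprn_ge0 ?exprn_ile1 //; by rewrite cnormM mulr_ile1.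
rewrite mul1r ler_wpM2r // ler_nat; exact: leq_trans (leq_subr _ _) id.
Qed.

Lemma homog_wedge d p q : exists2 K : R, 0 <= K & forall a b c e,
  cnorm a <= 1 -> cnorm b <= 1 -> cnorm c <= 1 -> cnorm e <= 1 ->
  cnorm (homog d p a b * homog d q c e - homog d q a b * homog d p c e)
   <= K * cnorm (a * e - b * c).
Proof.
exists (\sum_(i < d.+1) \sum_(j < d.+1) cnorm p`_i * cnorm q`_j * d%:R).
  by do 2! (apply: sumr_ge0 => ? _); rewrite !mulr_ge0.
move=> a b c e a1 b1 c1 e1; rewrite (mulrC (homog d q a b)) /homog !mulr_suml.
have -> : \sum_(i < d.+1) (p`_i * a ^+ i * b ^+ (d - i) *
        \sum_(j < d.+1) q`_j * c ^+ j * e ^+ (d - j)) -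
    \sum_(i < d.+1) (p`_i * c ^+ i * e ^+ (d - i) *
        \sum_(j < d.+1) q`_j * a ^+ j * b ^+ (d - j)) =
   \sum_(i < d.+1) \sum_(j < d.+1) p`_i * q`_j *
     (a ^+ i * b ^+ (d - i) * (c ^+ j * e ^+ (d - j))
       - a ^+ j * b ^+ (d - j) * (c ^+ i * e ^+ (d - i))).
  rewrite -sumrB; apply: eq_bigr => i _; rewrite !mulr_sumr -sumrB.
  by apply: eq_bigr => j _; ring.
apply: (le_trans (cnorm_sum _ _ _)); apply: ler_sum => i _.
apply: (le_trans (cnorm_sum _ _ _)); rewrite mulr_suml; apply: ler_sum => j _.
rewrite cnormM (cnormM p`_i) -[leRHS]mulrA ler_wpM2l ?mulr_ge0 //.
by apply: monomial_wedge => //; rewrite -ltnS.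
Qed.

(** The homogenisation read in the chart at infinity, where it makes the lower bound for coprime
    polynomials available as well. *)
Definition revp d p : {poly R[i]} := \sum_(i < d.+1) p`_i *: 'X^(d - i).

Lemma horner_revp d p b : (revp d p).[b] = homog d p 1 b.
Proof.
by rewrite horner_sum; apply: eq_bigr => i _; rewrite hornerZ hornerXn expr1n mulr1.
Qed.

(** On unit representatives the wedge of the images is at most K times the wedge of the points,
    while Bezout in both charts keeps the images away from (0,0). The factor 4 bounds the product of
    the two norms of the representatives. *)
Lemma rat_chord_lipschitz (g : Defs.Rat R) :
  exists2 L : R, 0 <= L & forall x y, chord2 (g x) (g y) <= L * chord2 x y.
Proof.
case: g => f /= [p [q [q0 pq deg ->]]]; pose d := rdeg p q.
have [K K0 HK] := homog_wedge d p q.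
have nz a b : (a != 0) || (b != 0) -> (homog d p a b != 0) || (homog d q a b != 0).
  exact: homog_neq0.
have h1 (s : {poly R[i]}) z : (size s <= d.+1)%N -> s.[z] = homog d s z 1.
  by move=> ss; rewrite homogE ?oner_eq0 // expr1n mul1r divr1.
have sp : (size p <= d.+1)%N by rewrite /d /rdeg prednK ?leq_maxl // (leq_trans _ deg).
have sq : (size q <= d.+1)%N by rewrite /d /rdeg prednK ?leq_maxr // (leq_trans _ deg).
have [m1 m10 H1] := coprime_lower_bound pq.
have [|m2 m20 H2] := @coprime_lower_bound (revp d p) (revp d q).
  apply: Pdiv.ClosedField.root_coprimep => b; rewrite /root !horner_revp => /eqP E.
  by have := @nz 1 b; rewrite oner_eq0 E eqxx => /(_ isT).
pose m := Num.min m1 m2; have m0 : 0 < m by rewrite lt_min m10.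
have Hm a b : unit_rep a b -> m <= hnorm2 (homog d p a b) (homog d q a b).
  case=> a1 b1 [E|E]; rewrite E /m ge_min.
    by rewrite -!horner_revp H2 ?orbT.
  by rewrite -!h1 // H1.
exists (4 * K ^+ 2 / m ^+ 2).
  by rewrite divr_ge0 ?sqr_ge0 // mulr_ge0 // sqr_ge0.
move=> x y; have [a [b [ab ->]]] := unit_rep_ex x; have [c [e [ce ->]]] := unit_rep_ex y.
have ab0 := unit_rep_neq0 ab; have ce0 := unit_rep_neq0 ce.
rewrite !rat_of_hpoint // -/d !chord2_hpoint ?nz //.
have hab := hnorm2_gt0 ab0; have hce := hnorm2_gt0 ce0.
have n1 := Hm _ _ ab; have n2 := Hm _ _ ce.
have := unit_rep_hnorm2 ab; have := unit_rep_hnorm2 ce => t2 t1.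
case: ab ce => [a1 b1 _] [c1 e1 _].
have N0 := HK _ _ _ _ a1 b1 c1 e1.
set W := cnorm (a * e - b * c) in N0 *; have W0 : 0 <= W by exact: cnorm_ge0.
apply: (@le_trans _ _ ((K * W) ^+ 2 / m ^+ 2)).
  apply: ler_pM; rewrite ?sqr_ge0 ?invr_ge0 //.
  - by rewrite mulr_ge0 // (le_trans (ltW m0)).
  - by rewrite ler_sqr ?nnegrE // mulr_ge0.
  - rewrite lef_pV2 ?posrE ?exprn_gt0 ?mulr_gt0 ?(lt_le_trans m0) //.
    by rewrite expr2 ler_pM // ltW.
rewrite exprMn.
have -> : 4 * K ^+ 2 / m ^+ 2 * (W ^+ 2 / (hnorm2 a b * hnorm2 c e)) =
  K ^+ 2 * W ^+ 2 / m ^+ 2 * (4 / (hnorm2 a b * hnorm2 c e)).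
  by field; rewrite !gt_eqF.
rewrite ler_peMr //; first by rewrite divr_ge0 ?sqr_ge0 // mulr_ge0 ?sqr_ge0.
rewrite ler_pdivlMr ?mulr_gt0 // mul1r (_ : 4 = 2 * 2); last by ring.
by rewrite ler_pM // ltW.
Qed.

(** In homogeneous coordinates, t -> (w - t) / (1 + conj(w) t) is a scalar multiple of a unitary
    map: it is the rotation of the sphere, an involution, that exchanges 0 and w. *)
Lemma rot_hnorm2 w t :
  hnorm2 (w - t) (1 + w^*%C * t) = (1 + cnorm w ^+ 2) * (1 + cnorm t ^+ 2).
Proof.
by rewrite /hnorm2 !cnorm_sqr; case: w t => [a b] [c e] /=; ring.
Qed.

Lemma rot_neq0 w t : (w - t != 0) || (1 + w^*%C * t != 0).
Proof.
have : 0 < hnorm2 (w - t) (1 + w^*%C * t).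
  by rewrite rot_hnorm2 mulr_gt0 // ltr_pwDl // sqr_ge0.
case: eqP => //= ->; case: eqP => //= ->.
by rewrite /hnorm2 cnorm0 expr0n addr0 ltxx.
Qed.

Lemma hpoint_Some w : Some w = hpoint w 1.
Proof. by rewrite /hpoint oner_eq0 divr1. Qed.

Lemma chord2_rot w t :
  chord2 (hpoint (w - t) (1 + w^*%C * t)) (Some w) = cnorm t ^+ 2 / (1 + cnorm t ^+ 2).
Proof.
rewrite hpoint_Some chord2_hpoint ?rot_neq0 ?oner_eq0 ?orbT // rot_hnorm2.
rewrite /hnorm2 cnorm1 expr1n.
have -> : (w - t) * 1 - (1 + w^*%C * t) * w = - t * (1 + w^*%C * w) by ring.
rewrite cnormM cnormN.
have -> : cnorm (1 + w^*%C * w) = 1 + cnorm w ^+ 2.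
  have -> : 1 + w^*%C * w = (1 + cnorm w ^+ 2)%:C.
    by rewrite cnorm_sqr; case: w => a b; apply/eqP; rewrite eq_complex /=; apply/andP; split; apply/eqP; ring.
  by rewrite cnorm_real ger0_norm // addr_ge0 // sqr_ge0.
have h1 : 1 + cnorm w ^+ 2 != 0 by rewrite gt_eqF // ltr_pwDl // sqr_ge0.
have h2 : 1 + cnorm t ^+ 2 != 0 by rewrite gt_eqF // ltr_pwDl // sqr_ge0.
by rewrite (addrC _ 1); field; rewrite h1 h2.
Qed.

(** The hypothesis excludes the antipode of w, the only point whose preimage under the rotation is
    infinite. As the rotation is an involution, the parameter is the image of x. *)
Lemma rot_ex w x : chord2 x (Some w) < 1 ->
  exists t, x = hpoint (w - t) (1 + w^*%C * t).
Proof.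
have n0 : 1 + w^*%C * w != 0.
  by have := rot_neq0 w w; rewrite subrr eqxx.
case: x => [z|] /= H.
  have [E|zw] := eqVneq (1 + w^*%C * z) 0.
    exfalso; move: H; apply/negP; rewrite -leNgt ler_pdivlMr; last first.
      by rewrite mulr_gt0 // ltr_pwDl // sqr_ge0.
    have := congr1 (fun u => cnorm u ^+ 2) E; rewrite cnorm0 expr0n /=.
    by rewrite !cnorm_sqr; case: w z {E n0} => [a b] [c e] /=; lra.
  exists ((w - z) / (1 + w^*%C * z)).
  have -> : w - (w - z) / (1 + w^*%C * z) = z * (1 + w^*%C * w) / (1 + w^*%C * z).
    by field.
  have -> : 1 + w^*%C * ((w - z) / (1 + w^*%C * z)) = (1 + w^*%C * w) / (1 + w^*%C * z).
    by field.
  by rewrite /hpoint mulf_eq0 invr_eq0 (negbTE n0) (negbTE zw) /=; congr Some; field; rewrite zw.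
have w0 : w^*%C != 0.
  rewrite conjc_eq0; apply/eqP => E; move: H.
  by rewrite E cnorm0 expr0n addr0 invr1 ltxx.
by exists (- (w^*%C)^-1); rewrite /hpoint mulrN divff // subrr eqxx.
Qed.

Lemma lagrange_identity (a b c e : R[i]) :
  cnorm (a * e - b * c) ^+ 2 + cnorm (a * c^*%C + b * e^*%C) ^+ 2 =
  hnorm2 a b * hnorm2 c e.
Proof.
rewrite /hnorm2 !cnorm_sqr.
by case: a b c e => [a1 a2] [b1 b2] [c1 c2] [e1 e2] /=; ring.
Qed.

(* A map contracting all r-balls into hemispheres is Lipschitz with a constant
   depending on r only: after rotations this is the Schwarz lemma. *)
Lemma rat_schwarz (g : Defs.Rat R) (r : R) : 0 < r <= 1 ->
  (forall x y, chord2 x y <= r ^+ 2 -> chord2 (g x) (g y) <= 2^-1) ->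
  forall x y, chord2 (g x) (g y) <= 2 / r ^+ 2 * chord2 x y.
Proof.
case: g => f /= [p [q [q0 pq deg ->]]] /andP[r0 r1] Hr.
have r20 : 0 < r ^+ 2 by rewrite exprn_gt0.
suff main x w : chord2 (rat_of p q x) (rat_of p q (Some w)) <= 2 / r ^+ 2 * chord2 x (Some w).
  move=> x [w|] //; case: x => [z|]; last by rewrite !chord2xx mulr0.
  by rewrite chord2C (chord2C (Some z)).
(* For distant points the bound exceeds 1, the diameter in [chord2]; only near points require the
   Schwarz lemma. *)
have [big|small] := leP (r ^+ 2 / 2) (chord2 x (Some w)).
  apply: (le_trans (chord2_le1 _ _)).
  by rewrite mulrAC ler_pdivlMr // mul1r; lra.
have r21 : r ^+ 2 <= 1 by rewrite expr_le1 // ltW.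
have [|t Et] := @rot_ex w x; first by lra.
pose d := rdeg p q.
pose rotp (s : {poly R[i]}) := \sum_(i < d.+1) s`_i *: ((w%:P - 'X) ^+ i *
   (1 + w^*%C *: 'X) ^+ (d - i)).
have rotpE s u : (rotp s).[u] = homog d s (w - u) (1 + w^*%C * u).
  rewrite /rotp horner_sum; apply: eq_bigr => i _.
  by rewrite hornerZ hornerM !horner_exp !(hornerD, hornerN, hornerZ, hornerX, hornerC) mulrA.
pose p0 := homog d p w 1; pose h0 := homog d q w 1.
(* [A] and [B] are the coordinates of the map after a rotation of the target taking the image of [w]
   to 0. By Lagrange's identity the squared chordal distance to that image is |A|^2 / (|A|^2 +
   |B|^2), so landing in the hemisphere around it means |A| <= |B|. *)
pose A := h0 *: rotp p - p0 *: rotp q.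
pose B := p0^*%C *: rotp p + h0^*%C *: rotp q.
have nz0 : (p0 != 0) || (h0 != 0) by apply: homog_neq0 => //; rewrite oner_eq0 orbT.
have EA u : A.[u] = (rotp p).[u] * h0 - (rotp q).[u] * p0.
  by rewrite /A !(hornerD, hornerN, hornerZ); ring.
have EB u : B.[u] = (rotp p).[u] * p0^*%C + (rotp q).[u] * h0^*%C.
  by rewrite /B !(hornerD, hornerN, hornerZ); ring.
pose N u := hnorm2 (rotp p).[u] (rotp q).[u] * hnorm2 p0 h0.
have N0 u : 0 < N u.
  rewrite mulr_gt0 ?hnorm2_gt0 // !rotpE.
  by apply: homog_neq0 => //; exact: rot_neq0.
have NE u : cnorm A.[u] ^+ 2 + cnorm B.[u] ^+ 2 = N u.
  by rewrite EA EB lagrange_identity.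
have chE u : chord2 (rat_of p q (hpoint (w - u) (1 + w^*%C * u))) (rat_of p q (Some w))
   = cnorm A.[u] ^+ 2 / N u.
  rewrite hpoint_Some !rat_of_hpoint ?oner_eq0 ?orbT ?rot_neq0 // -/d.
  rewrite chord2_hpoint ?homog_neq0 ?rot_neq0 ?oner_eq0 ?orbT //.
  by rewrite EA /N !rotpE.
have Hdisc u : cnorm u <= r -> B.[u] != 0 /\ cnorm A.[u] <= cnorm B.[u].
  move=> ur; have h : chord2 (hpoint (w - u) (1 + w^*%C * u)) (Some w) <= r ^+ 2.
    have u2 : cnorm u ^+ 2 <= r ^+ 2 by rewrite ler_sqr ?nnegrE // ltW.
    rewrite chord2_rot ler_pdivrMr; last by rewrite ltr_pwDl // sqr_ge0.
    by have := sqr_ge0 (cnorm u); nra.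
  have := Hr _ _ h; rewrite chE ler_pdivrMr // -NE => h2.
  have AB : cnorm A.[u] ^+ 2 <= cnorm B.[u] ^+ 2 by lra.
  split; last by rewrite -ler_sqr ?nnegrE.
  apply/eqP => B0; have := N0 u; rewrite -NE B0 cnorm0 expr0n /= addr0.
  by move: AB; rewrite B0 cnorm0 expr0n /=; lra.
have A0 : A.[0] = 0.
  by rewrite EA !rotpE subr0 mulr0 addr0 -/p0 -/h0 mulrC subrr.
have t2 : cnorm t ^+ 2 * (1 - chord2 x (Some w)) = chord2 x (Some w).
  by rewrite Et chord2_rot; field; rewrite gt_eqF // ltr_pwDl // sqr_ge0.
(* From chord2 = |t|^2 / (1 + |t|^2) < 1/2; this is the source of the 2 in the Lipschitz
   constant. *)
have tS : cnorm t ^+ 2 <= 2 * chord2 x (Some w).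
  have S2 : 0 <= 2^-1 - chord2 x (Some w) by lra.
  by have := mulr_ge0 (sqr_ge0 (cnorm t)) S2; lra.
have tr : cnorm t <= r by rewrite -ler_sqr ?nnegrE ?(ltW r0) //; lra.
have := schwarz r0 A0 Hdisc tr.
rewrite -ler_sqr ?nnegrE ?mulr_ge0 ?(ltW r0) // !exprMn => hS.
rewrite {1}Et chE ler_pdivrMr // mulrAC -mulrA mulrAC ler_pdivlMr // mulrC.
apply: (le_trans hS).
have B2 : cnorm B.[t] ^+ 2 <= N t by rewrite -NE lerDr sqr_ge0.
rewrite [leRHS](_ : _ = 2 * chord2 x (Some w) * N t); last by ring.
by apply: ler_pM; rewrite ?sqr_ge0.
Qed.

End RationalMaps.

(** * Uniform distance of rational maps: locally bounded Lipschitz constants and total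
    boundedness *)

Section UniformMetric.
Variable R : realType.
Implicit Types (x y : sphere R) (f g h : Defs.Rat R).

Definition lipschitz_rat (L : R) g := forall x y, sdist (g x) (g y) <= L * sdist x y.

Lemma lipschitz_of_chord2 (L M : R) g : 0 <= M -> 64 * L <= M ^+ 2 ->
  (forall x y, chord2 (g x) (g y) <= L * chord2 x y) -> lipschitz_rat M g.
Proof.
move=> M0 LM H x y; rewrite -ler_sqr ?nnegrE ?sdist_ge0 ?mulr_ge0 ?sdist_ge0 //.
apply: (le_trans (sdist_le_chord2 _ _)); rewrite exprMn.
apply: (@le_trans _ _ (64 * (L * chord2 x y))); first by rewrite ler_pM2l.
rewrite mulrA; apply: (@le_trans _ _ (M ^+ 2 * chord2 x y)).
  by rewrite ler_wpM2r // chord2_ge0.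
by rewrite ler_wpM2l ?sqr_ge0 // chord2_le_sdist.
Qed.

Lemma rat_lipschitz g : exists2 L : R, 0 <= L & lipschitz_rat L g.
Proof.
have [L L0 H] := rat_chord_lipschitz g.
exists (8 * (L + 1)); first by lra.
by apply: lipschitz_of_chord2 H; nra.
Qed.

Let kset f g := [set sdist (f z) (g z) | z in [set: sphere R]].

Let kset_sup f g : has_sup (kset f g).
Proof.
split; first by exists (sdist (f None) (g None)); exists None.
by exists pi => _ [z _ <-]; exact: sdist_lepi.
Qed.

Lemma sdist_le_kappa f g x : sdist (f x) (g x) <= kappa f g.
Proof. by apply: sup_upper_bound; [exact: kset_sup|exists x]. Qed.

Lemma kappa_le f g (r : R) : (forall x, sdist (f x) (g x) <= r) -> kappa f g <= r.
Proof.
by move=> H; apply: sup_le_ub; [case: (kset_sup f g)|move=> _ [z _ <-]].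
Qed.

Lemma kappaxx f : kappa f f = 0.
Proof.
apply/eqP; rewrite eq_le; apply/andP; split.
  by apply: kappa_le => x; rewrite sdistxx.
by rewrite -(sdistxx (f None)) sdist_le_kappa.
Qed.

Lemma kappa_triangle g f h : kappa f h <= kappa f g + kappa g h.
Proof.
apply: kappa_le => x; apply: (le_trans (sdist_triangle (g x) _ _)).
by rewrite lerD // sdist_le_kappa.
Qed.

(** If [g] moves the images of points of a small ball apart by at most pi/4, a map within pi/8 of
    [g] moves them apart by at most pi/4 + 2 pi/8 = pi/2. It thus sends balls of a radius depending
    on [g] alone into hemispheres. *)
Lemma kappa_ball_lipschitz g : exists2 r : R, 0 < r & exists2 L : R, 0 <= L &
  forall f, kappa g f < r -> lipschitz_rat L f.
Proof.
have [L0 L00 H0] := rat_lipschitz g; have pi0 := @pi_gt0 R.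
pose r : R := Num.min 1 (pi / (32 * (L0 + 1))).
have L1 : 0 < 32 * (L0 + 1) by lra.
have r0 : 0 < r by rewrite lt_min ltr01 divr_gt0.
have r1 : r <= 1 by rewrite ge_min lexx.
have rL : L0 * (8 * r) <= pi / 4.
  have : r <= pi / (32 * (L0 + 1)) by rewrite ge_min lexx orbT.
  by rewrite ler_pdivlMr //; nra.
exists (pi / 8); first by lra.
(* 64 from the comparison of the distances times 2 from the Schwarz bound is 128 <= 12^2. *)
exists (12 / r); first by rewrite divr_ge0 // ltW.
move=> f fg; apply: (@lipschitz_of_chord2 (2 / r ^+ 2)).
- by rewrite divr_ge0 // ltW.
- by rewrite expr_div_n mulrA ler_pM2r ?invr_gt0 ?exprn_gt0 //; lra.
apply: rat_schwarz => [|x y xy]; first by rewrite r0.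
rewrite -sdist_pihalf.
have d8 : sdist x y <= 8 * r.
  rewrite -ler_sqr ?nnegrE ?sdist_ge0 ?mulr_ge0 ?(ltW r0) //.
  by apply: (le_trans (sdist_le_chord2 _ _)); rewrite exprMn; nra.
have h1 : sdist (f x) (g x) < pi / 8.
  by rewrite sdistC; apply: le_lt_trans fg; exact: sdist_le_kappa.
have h2 : sdist (g y) (f y) < pi / 8 by apply: le_lt_trans fg; exact: sdist_le_kappa.
have h3 : sdist (g x) (g y) <= pi / 4.
  by apply: (le_trans (H0 _ _)); apply: le_trans rL; rewrite ler_wpM2l.
apply: (le_trans (sdist_triangle (g x) _ _)).
have := sdist_triangle (g y) (g x) (f y); lra.
Qed.

(** Total boundedness as a finite colouring: points are coloured by the cube of side 1/n that
    contains their stereographic image in space. Equal colours give squared distance at most 16 * 3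
    / n^2, below 49 / n^2 <= e^2. *)
Lemma sphere_code (e : R) : 0 < e -> exists (K : finType) (c : sphere R -> K),
  forall x y, c x = c y -> sdist x y <= e.
Proof.
move=> e0; pose n := (Num.truncn (7 / e)).+1.
have ne : 7 / e < n%:R by exact: truncnS_gt.
have n0 : 0 < n%:R :> R by rewrite ltr0n.
pose code (a : R) : 'I_(2 * n).+1 := inord (Num.truncn (n%:R * (a + 1))).
have codeP (a b : R) : -1 <= a <= 1 -> -1 <= b <= 1 -> code a = code b ->
    (n%:R * (a - b)) ^+ 2 <= 1.
  have cval (u : R) : -1 <= u <= 1 -> (Num.truncn (n%:R * (u + 1)) <= 2 * n)%N.
    move=> u1; rewrite -ltnS truncn_lt_nat; last by rewrite mulr_ge0 ?(ltW n0) //; lra.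
    rewrite -natr1 natrM; have : n%:R * (u + 1) <= n%:R * 2 by rewrite ler_pM2l //; lra.
    lra.
  move=> a1 b1 /(congr1 (@nat_of_ord _)); rewrite !inordK ?ltnS ?cval // => E.
  have Ha := @truncn_itv R (n%:R * (a + 1)); have Hb := @truncn_itv R (n%:R * (b + 1)).
  have /Ha : 0 <= n%:R * (a + 1) by rewrite mulr_ge0 ?(ltW n0) //; lra.
  have /Hb : 0 <= n%:R * (b + 1) by rewrite mulr_ge0 ?(ltW n0) //; lra.
  rewrite E -natr1 => /andP[h1 h2] /andP[h3 h4].
  by rewrite mulrBr; nra.
have bnd x : let: (a1, a2, a3) := stereo x in [/\ -1 <= a1 <= 1, -1 <= a2 <= 1 & -1 <= a3 <= 1].
  have := stereo_norm x; case: (stereo x) => [[a1 a2] a3] H; split; nra.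
exists ('I_(2 * n).+1 * 'I_(2 * n).+1 * 'I_(2 * n).+1)%type.
exists (fun x => let: (a1, a2, a3) := stereo x in (code a1, code a2, code a3)).
move=> x y; have := chord2_stereo x y; have := bnd x; have := bnd y.
case: (stereo x) => [[a1 a2] a3]; case: (stereo y) => [[b1 b2] b3].
move=> [b1' b2' b3'] [a1' a2' a3'] H [E1 E2 E3].
rewrite -ler_sqr ?nnegrE ?sdist_ge0 ?(ltW e0) //; apply: (le_trans (sdist_le_chord2 _ _)).
have := codeP _ _ a1' b1' E1; have := codeP _ _ a2' b2' E2; have := codeP _ _ a3' b3' E3.
rewrite !exprMn => h3 h2 h1.
have h : n%:R ^+ 2 * (4 * chord2 x y) <= 3 by rewrite H !mulrDr; lra.
have n2 : 0 < n%:R ^+ 2 :> R by rewrite exprn_gt0.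
rewrite -(ler_pM2l n2); apply: (@le_trans _ _ 49); first by lra.
have : 7 <= n%:R * e by rewrite -ler_pdivrMr // ltW.
by rewrite -exprMn; nra.
Qed.

(** The totally bounded half of Arzela-Ascoli: an L-Lipschitz map is determined up to e by the
    colours of its values at one representative per colour. With d = e / (2L + 1) the error is L d +
    d + L d. *)
Lemma rat_code (L e : R) : 0 <= L -> 0 < e -> exists (K : finType) (c : Defs.Rat R -> K),
  forall f g, lipschitz_rat L f -> lipschitz_rat L g -> c f = c g -> kappa f g <= e.
Proof.
move=> L0 e0; have L1 : 0 < 2 * L + 1 by lra.
have [K [c Hc]] := sphere_code (divr_gt0 e0 L1).
pose rep (k : K) : sphere R := xget None [set x | c x = k].
have repP x : c (rep (c x)) = c x.
  by rewrite /rep; apply: (@xgetPex _ None [set z | c z = c x]); exists x.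
exists {ffun K -> K}, (fun f => [ffun k => c (f (rep k))]).
move=> f g Lf Lg /ffunP E; apply: kappa_le => x.
have := E (c x); rewrite !ffunE => /Hc h1.
have h2 := Hc _ _ (repP x); have h3 := Hc _ _ (esym (repP x)).
set x' := rep (c x) in h1 h2 h3.
have h4 : sdist (f x) (f x') <= L * (e / (2 * L + 1)).
  by apply: (le_trans (Lf _ _)); rewrite ler_wpM2l.
have h5 : sdist (g x') (g x) <= L * (e / (2 * L + 1)).
  by apply: (le_trans (Lg _ _)); rewrite ler_wpM2l.
have h6 : e = (2 * L + 1) * (e / (2 * L + 1)) by rewrite mulrC divfK // gt_eqF.
have := sdist_triangle (f x') (f x) (g x); have := sdist_triangle (g x') (f x') (g x).
by rewrite h6; lra.
Qed.

End UniformMetric.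

(** * Full measure near the support, and one Lipschitz constant for almost every map *)

Section Support.
Variable R : realType.
Variable tau : probability (RatM R) R.

Lemma mopen_kappa_measurable (A : set (RatM R)) : mopen (@kappa R) A -> measurable A.
Proof. by move=> oA; apply: sub_sigma_algebra. Qed.

Lemma kappa_ball_mopen (f : Defs.Rat R) (r : R) : mopen (@kappa R) [set g | kappa f g < r].
Proof.
move=> g /= fg; exists (r - kappa f g); first by rewrite subr_gt0.
move=> h gh /=; apply: (le_lt_trans (kappa_triangle g _ _)); lra.
Qed.

Let ball (f : Defs.Rat R) (r : R) : set (RatM R) := [set g | kappa f g < r].

(** A Lindelof argument. Every map off the support has a null ball and is m-Lipschitz for some m;
    for each m and each scale there are finitely many colours, and one null ball per colour
    suffices. Countably many null balls cover the complement of U. *)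
Lemma supp_conull (U : set (RatM R)) : mopen (@kappa R) U -> supp tau `<=` U ->
  tau (~` U) = 0%E.
Proof.
move=> oU sU; have mU := mopen_kappa_measurable oU.
have mball f r : measurable (ball f r).
  by apply: mopen_kappa_measurable; exact: kappa_ball_mopen.
have ex_code (m n : nat) : exists c : Defs.Rat R -> nat, forall f g,
    lipschitz_rat m%:R f -> lipschitz_rat m%:R g -> c f = c g -> kappa f g <= n.+1%:R^-1.
  have [|K [c Hc]] := @rat_code R m%:R n.+1%:R^-1 (ler0n _ _); first by rewrite invr_gt0.
  exists (fun f => pickle (c f)) => f g Lf Lg E; apply: Hc => //.
  by apply: (pcan_inj pickleK).
have [c Hc] := choice (fun mn : nat * nat => ex_code mn.1 mn.2).
(* Twice the diameter bound of a colour class, so that the open ball around any chosen centre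
   contains all of the class. *)
pose rad (n : nat) : R := 2 * n.+1%:R^-1.
pose cand (i : nat * nat * nat) : set (Defs.Rat R) :=
  [set f | [/\ lipschitz_rat i.1.1%:R f, c i.1 f = i.2 & tau (ball f (rad i.1.2)) = 0%E]].
pose ctr i := xget point (cand i).
(* A class without a candidate gets the default centre, whose ball may have positive mass; the test
   replaces such a ball by the empty set. *)
pose N (i : nat * nat * nat) : set (RatM R) :=
  if tau (ball (ctr i) (rad i.1.2)) == 0%E then ball (ctr i) (rad i.1.2) else set0.
pose NN (k : nat) : set (RatM R) := if unpickle k is Some i then N i else set0.
have negN k : tau.-negligible (NN k).
  rewrite /NN; case: (unpickle k) => [i|]; last exact: negligible_set0.
  rewrite /N; case: eqP => [E|_]; last exact: negligible_set0.
  by apply/negligibleP.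
have cover : ~` U `<=` \bigcup_k NN k.
  move=> g gU.
  have [r r0 rg] : exists2 r : R, 0 < r & tau (ball g r) = 0%E.
    apply: contrapT => H; apply: gU; apply: sU => r r0.
    rewrite lt0e measure_ge0 andbT; apply/eqP => E; apply: H.
    by exists r.
  have [L L0 Lg] := rat_lipschitz g.
  pose m := (Num.truncn L).+1; pose n := (Num.truncn (2 / r)).+1.
  have Lm : lipschitz_rat m%:R g.
    move=> x y; apply: (le_trans (Lg x y)); rewrite ler_wpM2r ?sdist_ge0 //.
    by rewrite ltW // truncnS_gt.
  have nr : rad n <= r.
    rewrite /rad ler_pdivrMr // mulrC -ler_pdivrMr //.
    apply: ltW; apply: (lt_trans (truncnS_gt _)).
    by rewrite ltr_nat.
  pose i := (m, n, c (m, n) g).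
  have ci : cand i (ctr i).
    apply: (@xgetPex _ point (cand i)); exists g; split => //.
    apply/eqP; rewrite eq_le measure_ge0 andbT -rg; apply: le_measure; rewrite ?inE //.
    by move=> h /= /lt_le_trans; apply.
  case: ci => L1 E1 T1; exists (pickle i) => //.
  rewrite /NN pickleK /N T1 eqxx /ball /=.
  have /= := Hc (m, n) _ _ L1 Lm E1; move/le_lt_trans; apply.
  by rewrite /rad -{1}[n.+1%:R^-1]mul1r ltr_pM2r ?invr_gt0 // ltr1n.
have : tau.-negligible (~` U).
  by apply: negligibleS cover _; exact: negligible_bigcup.
by move/negligibleP; apply; exact: measurableC.
Qed.

(** Asking for the bound on a whole neighbourhood makes the sets [V n] open; they increase with n
    and cover, so compactness leaves a single n. *)
Lemma supp_lipschitz : compact_supp tau ->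
  exists2 L : R, 0 <= L & exists2 U : set (RatM R), measurable U & tau (~` U) = 0%E
    /\ forall g, U g -> lipschitz_rat L g.
Proof.
move=> cs.
pose V (n : nat) : set (Defs.Rat R) := [set g | exists2 r : R, 0 < r &
  forall f, kappa g f < r -> lipschitz_rat n%:R f].
have oV n : mopen (@kappa R) (V n).
  move=> g [r r0 H]; exists (r / 2); first by lra.
  move=> f gf; exists (r / 2); first by lra.
  move=> h fh; apply: H; apply: (le_lt_trans (kappa_triangle f _ _)); lra.
have covV : supp tau `<=` \bigcup_n V n.
  move=> g _; have [r r0 [L L0 H]] := kappa_ball_lipschitz g.
  exists (Num.truncn L).+1 => //; exists r => // f gf x y.
  apply: (le_trans (H f gf x y)); rewrite ler_wpM2r ?sdist_ge0 //.
  by rewrite ltW // truncnS_gt.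
have [F finF FV] := cs _ _ oV covV.
have /finite_seqP[s Es] := finF.
pose N := \max_(n <- s) n.
have sV : supp tau `<=` V N.
  move=> g /FV[n Fn [r r0 H]]; exists r => // f gf x y.
  apply: (le_trans (H f gf x y)); rewrite ler_wpM2r ?sdist_ge0 // ler_nat.
  by apply: leq_bigmax_seq => //; move: Fn; rewrite Es.
exists N%:R => //; exists (V N); first exact: mopen_kappa_measurable.
split; first exact: supp_conull.
by move=> g [r r0 H]; apply: H; rewrite kappaxx.
Qed.

End Support.

(** * The transition operator on bounded continuous functions *)

Section TransitionOperator.
Variable R : realType.
Variable tau : probability (RatM R) R.
Implicit Types (x y z : sphere R) (phi psi : sphere R -> R[i]).

(** The bound is carried along with continuity because it yields integrability of g -> phi(g(z))
    directly. *)
Definition bcont phi := ccont phi /\ exists B : R, forall z, cnorm (phi z) <= B.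

Lemma bcontD phi psi : bcont phi -> bcont psi -> bcont (fun z => phi z + psi z).
Proof.
move=> [cp [A HA]] [cq [B HB]]; split; last first.
  by exists (A + B) => z; apply: (le_trans (cnormD _ _)); rewrite lerD.
move=> z e e0; have e2 : 0 < e / 2 by lra.
have [d1 d10 H1] := cp z _ e2; have [d2 d20 H2] := cq z _ e2.
exists (Num.min d1 d2); first by rewrite lt_min d10.
move=> w; rewrite lt_min => /andP[/H1 h1 /H2 h2].
have -> : phi w + psi w - (phi z + psi z) = (phi w - phi z) + (psi w - psi z) by ring.
by apply: (le_lt_trans (cnormD _ _)); lra.
Qed.

Lemma bcontZ a phi : bcont phi -> bcont (fun z => a * phi z).
Proof.
move=> [cp [A HA]]; split; last first.
  by exists (cnorm a * A) => z; rewrite cnormM ler_wpM2l.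
have a1 : 0 < cnorm a + 1 by rewrite ltr_wpDl.
move=> z e e0; have [d d0 H] := cp z _ (divr_gt0 e0 a1).
exists d => // w /H h; rewrite -mulrBr cnormM.
apply: (@le_lt_trans _ _ ((cnorm a + 1) * cnorm (phi w - phi z))).
  by rewrite ler_wpM2r // lerDl.
by rewrite mulrC -ltr_pdivlMr.
Qed.

Lemma kappa_continuous_measurable (F : RatM R -> R) :
  (forall g (e : R), 0 < e -> exists2 del : R, 0 < del &
     forall h, kappa g h < del -> `|F h - F g| < e) ->
  measurable_fun setT F.
Proof.
move=> cF; apply: (measurability _ (measurable_realfun.RGenOInfty.measurableE R)).
move=> /= _ [_ [a ->]] <-; rewrite setTI; apply: mopen_kappa_measurable.
move=> g /=; rewrite in_itv /= andbT => ag.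
have [|d d0 H] := cF g (F g - a); first by rewrite subr_gt0.
exists d => // h /H; rewrite ltr_norml => /andP[h1 _]; rewrite /= in_itv /= andbT; lra.
Qed.

Definition ev z (g : RatM R) : sphere R := (g : Defs.Rat R) z.

Lemma bcont_continuous phi z (p : R[i] -> R) : bcont phi ->
  (forall u v, `|p u - p v| <= cnorm (u - v)) ->
  forall g (e : R), 0 < e -> exists2 del : R, 0 < del &
     forall h, kappa g h < del -> `|p (phi (ev z h)) - p (phi (ev z g))| < e.
Proof.
move=> [cp _] Hp g e e0; have [d d0 H] := cp (ev z g) e e0.
exists d => // h gh; apply: (le_lt_trans (Hp _ _)); apply: H.
by apply: le_lt_trans gh; exact: sdist_le_kappa.
Qed.

Lemma Re_lip (u v : R[i]) : `|complex.Re u - complex.Re v| <= cnorm (u - v).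
Proof. by have := cnorm_Re (u - v); case: u v => [a b] [c d]. Qed.

Lemma Im_lip (u v : R[i]) : `|complex.Im u - complex.Im v| <= cnorm (u - v).
Proof. by have := cnorm_Im (u - v); case: u v => [a b] [c d]. Qed.

Lemma bounded_integrable (F : RatM R -> R) (B : R) : measurable_fun setT F ->
  (forall g, `|F g| <= B) -> tau.-integrable setT (EFin \o F).
Proof.
move=> mF HB; apply: measurable_bounded_integrable => //.
  by rewrite (le_lt_trans (probability_le1 _ _)) ?ltry.
exists B; split; first exact: num_real.
by move=> M BM g _ /=; apply: (le_trans (HB g)); exact: ltW.
Qed.

Lemma integrable_ev phi z (p : R[i] -> R) : bcont phi ->
  (forall u v, `|p u - p v| <= cnorm (u - v)) -> (forall u, `|p u| <= cnorm u) ->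
  tau.-integrable setT (EFin \o (fun g : RatM R => p (phi (ev z g)))).
Proof.
move=> bp Hp Hp1; have [_ [B HB]] := bp; apply: (@bounded_integrable _ B).
  by apply: kappa_continuous_measurable; exact: (bcont_continuous z bp Hp).
by move=> g; apply: (le_trans (Hp1 _)).
Qed.

Lemma integrable_Re phi z : bcont phi ->
  tau.-integrable setT (EFin \o (fun g : RatM R => complex.Re (phi (ev z g)))).
Proof. by move=> bp; apply: integrable_ev => //; [exact: Re_lip|exact: cnorm_Re]. Qed.

Lemma integrable_Im phi z : bcont phi ->
  tau.-integrable setT (EFin \o (fun g : RatM R => complex.Im (phi (ev z g)))).
Proof. by move=> bp; apply: integrable_ev => //; [exact: Im_lip|exact: cnorm_Im]. Qed.

Lemma MtauD phi psi : bcont phi -> bcont psi ->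
  Mtau tau (fun z => phi z + psi z) = (fun z => Mtau tau phi z + Mtau tau psi z).
Proof.
move=> bp bq; apply: funext => z; rewrite /Mtau /cint; apply/eqP.
rewrite eq_complex /=; apply/andP; split; apply/eqP.
  rewrite -(RintegralD measurableT (integrable_Re z bp) (integrable_Re z bq)).
  by apply: eq_Rintegral => g _; rewrite /ev; case: (phi _) => a b; case: (psi _).
rewrite -(RintegralD measurableT (integrable_Im z bp) (integrable_Im z bq)).
by apply: eq_Rintegral => g _; rewrite /ev; case: (phi _) => a b; case: (psi _).
Qed.

Lemma MtauZ a phi : bcont phi ->
  Mtau tau (fun z => a * phi z) = (fun z => a * Mtau tau phi z).
Proof.
move=> bp; apply: funext => z; rewrite /Mtau /cint; apply/eqP.
have iR := integrable_Re z bp; have iI := integrable_Im z bp.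
have iZ c (F : RatM R -> R) : tau.-integrable setT (EFin \o F) ->
    tau.-integrable setT (EFin \o (fun g => c * F g)).
  by move=> iF; exact: (integrableZl measurableT c iF).
case: a => [a b]; rewrite eq_complex /=; apply/andP; split; apply/eqP.
  rewrite -(RintegralZl _ measurableT iR) -(RintegralZl _ measurableT iI).
  rewrite -(RintegralB measurableT (iZ _ _ iR) (iZ _ _ iI)).
  by apply: eq_Rintegral => g _; rewrite /ev; case: (phi _).
rewrite -(RintegralZl _ measurableT iR) -(RintegralZl _ measurableT iI).
rewrite -(RintegralD measurableT (iZ _ _ iI) (iZ _ _ iR)).
by apply: eq_Rintegral => g _; rewrite /ev; case: (phi _).
Qed.

Lemma Rintegral_ae_bound (F : RatM R -> R) (U : set (RatM R)) (C : R) :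
  measurable U -> tau (~` U) = 0%E -> 0 <= C ->
  tau.-integrable setT (EFin \o F) -> (forall g, U g -> `|F g| <= C) ->
  `|Rintegral tau setT F| <= C.
Proof.
move=> mU tU C0 iF HF.
have iFU : tau.-integrable U (EFin \o F) by apply: integrableS iF.
have -> : Rintegral tau setT F = Rintegral tau U F.
  rewrite /Rintegral (@negligible_integral _ _ _ tau setT (~` U)) //.
    by rewrite setTD setCK.
  exact: measurableC.
apply: (le_trans (le_normr_Rintegral mU iFU)).
apply: (@le_trans _ _ (\int[tau]_(t in U) C)).
  apply: le_Rintegral => //; first exact: (integrable_norm iFU).
  by apply: finite_measure_integrable_cst.
rewrite Rintegral_cst // ler_piMr // -lee_fin fineK ?probability_le1 //.
by rewrite fin_num_measure.
Qed.

(** The factor 2 comes from estimating real and imaginary parts separately. It does no harm: the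
    rate of decay of the iterates is never taken from this bound. *)
Lemma Mtau_ae_bound phi (U : set (RatM R)) (C : R) z :
  measurable U -> tau (~` U) = 0%E -> 0 <= C -> bcont phi ->
  (forall g, U g -> cnorm (phi (ev z g)) <= C) -> cnorm (Mtau tau phi z) <= 2 * C.
Proof.
move=> mU tU C0 bp H; apply: (le_trans (cnorm_ReIm _)) => /=.
rewrite (_ : 2 * C = C + C); last by ring.
apply: lerD; apply: (Rintegral_ae_bound mU tU C0).
- exact: (integrable_Re z bp).
- by move=> g Ug; apply: (le_trans (cnorm_Re _)); exact: H.
- exact: (integrable_Im z bp).
- by move=> g Ug; apply: (le_trans (cnorm_Im _)); exact: H.
Qed.

Lemma Mtau_bound phi (C : R) : 0 <= C -> bcont phi ->
  (forall z, cnorm (phi z) <= C) -> forall z, cnorm (Mtau tau phi z) <= 2 * C.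
Proof.
move=> C0 bp H z; apply: (@Mtau_ae_bound phi setT) => //.
by rewrite setCT measure0.
Qed.

Lemma Mtau_ae_diff phi (U : set (RatM R)) (C : R) x y :
  measurable U -> tau (~` U) = 0%E -> 0 <= C -> bcont phi ->
  (forall g, U g -> cnorm (phi (ev x g) - phi (ev y g)) <= C) ->
  cnorm (Mtau tau phi x - Mtau tau phi y) <= 2 * C.
Proof.
move=> mU tU C0 bp H; apply: (le_trans (cnorm_ReIm _)) => /=.
rewrite (_ : 2 * C = C + C); last by ring.
have iB (F G : RatM R -> R) : tau.-integrable setT (EFin \o F) ->
    tau.-integrable setT (EFin \o G) ->
    tau.-integrable setT (EFin \o (fun g => F g - G g)).
  by move=> iF iG; exact: (integrableB measurableT iF iG).
have iRx := integrable_Re x bp; have iRy := integrable_Re y bp.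
have iIx := integrable_Im x bp; have iIy := integrable_Im y bp.
apply: lerD.
  rewrite -(RintegralB measurableT iRx iRy).
  apply: (Rintegral_ae_bound mU tU C0 (iB _ _ iRx iRy)) => g Ug.
  by apply: (le_trans (Re_lip _ _)); exact: H.
rewrite -(RintegralB measurableT iIx iIy).
apply: (Rintegral_ae_bound mU tU C0 (iB _ _ iIx iIy)) => g Ug.
by apply: (le_trans (Im_lip _ _)); exact: H.
Qed.

End TransitionOperator.

(** * Hoelder functions and boundedness of the transition operator on them *)

Section HolderSpace.
Variables (R : realType) (alpha : R).
Hypothesis alpha_gt0 : 0 < alpha.
Implicit Types (x y z : sphere R) (phi psi : sphere R -> R[i]).

(* Up to a factor 2, the least such A is the norm of C^alpha; unlike [hnorm],
   whose suprema are 0 on unbounded sets, the bound also entails membership. *)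
Definition hbound phi (A : R) := (forall z, cnorm (phi z) <= A) /\
  (forall x y, cnorm (phi x - phi y) <= A * sdist x y `^ alpha).

Lemma hbound_ge0 phi A : hbound phi A -> 0 <= A.
Proof. by case=> /(_ None) + _; apply: le_trans. Qed.

Lemma hboundW phi A B : A <= B -> hbound phi A -> hbound phi B.
Proof.
move=> AB [h1 h2]; split => [z|x y]; first exact: le_trans AB.
by apply: (le_trans (h2 x y)); rewrite ler_wpM2r // powR_ge0.
Qed.

Lemma hboundD phi psi A B : hbound phi A -> hbound psi B ->
  hbound (fun z => phi z + psi z) (A + B).
Proof.
move=> [h1 h2] [h3 h4]; split => [z|x y].
  by apply: (le_trans (cnormD _ _)); rewrite lerD.
have -> : phi x + psi x - (phi y + psi y) = (phi x - phi y) + (psi x - psi y) by ring.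
by apply: (le_trans (cnormD _ _)); rewrite mulrDl lerD.
Qed.

Lemma hboundZ a phi A : hbound phi A -> hbound (fun z => a * phi z) (cnorm a * A).
Proof.
move=> [h1 h2]; split => [z|x y]; first by rewrite cnormM ler_wpM2l.
by rewrite -mulrBr cnormM -mulrA ler_wpM2l.
Qed.

Lemma hboundB phi psi A B : hbound phi A -> hbound psi B ->
  hbound (fun z => phi z - psi z) (A + B).
Proof.
move=> h1 h2; have := hboundD h1 (hboundZ (-1) h2).
rewrite cnormN cnorm1 mul1r; congr hbound; apply: funext => z; by rewrite mulN1r.
Qed.

Lemma holder_hbound phi : holder alpha phi -> exists A, hbound phi A.
Proof.
move=> [K HK]; pose A := cnorm (phi None) + `|K| * (pi `^ alpha + 1).
exists A; split => [z|x y].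
  rewrite -[phi z](subrK (phi None)) addrC; apply: (le_trans (cnormD _ _)).
  rewrite lerD2l; apply: (le_trans (HK _ _)).
  apply: (@le_trans _ _ (`|K| * sdist z None `^ alpha)).
    by rewrite ler_wpM2r ?powR_ge0 // ler_norm.
  rewrite ler_wpM2l //; apply: (@le_trans _ _ (pi `^ alpha)); last by rewrite lerDl.
  by apply: ge0_ler_powR; rewrite ?nnegrE ?sdist_ge0 ?sdist_lepi ?pi_ge0 ?ltW.
apply: (le_trans (HK _ _)); rewrite ler_wpM2r ?powR_ge0 //.
apply: (le_trans (ler_norm _)); rewrite /A -[X in X <= _]mulr1.
apply: (@le_trans _ _ (`|K| * (pi `^ alpha + 1))); last by rewrite lerDr.
by rewrite ler_wpM2l // lerDr powR_ge0.
Qed.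

Lemma hbound_holder phi A : hbound phi A -> holder alpha phi.
Proof. by case=> _ h; exists A. Qed.

Lemma hbound_bcont phi A : hbound phi A -> bcont phi.
Proof.
move=> [h1 h2]; split; last by exists A.
have A0 : 0 <= A by apply: le_trans (h1 None).
move=> z e e0; have A1 : 0 < A + 1 by lra.
have eA : 0 < e / (A + 1) by rewrite divr_gt0.
exists ((e / (A + 1)) `^ (alpha^-1)); first by rewrite powR_gt0.
move=> w zw; apply: (le_lt_trans (h2 _ _)); rewrite sdistC.
have h : sdist z w `^ alpha < e / (A + 1).
  have -> : e / (A + 1) = ((e / (A + 1)) `^ alpha^-1) `^ alpha.
    by rewrite -powRrM mulVf ?gt_eqF // powRr1 // ltW.
  by apply: gt0_ltr_powR => //; rewrite ?nnegrE ?sdist_ge0 ?powR_ge0.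
apply: (@le_lt_trans _ _ ((A + 1) * sdist z w `^ alpha)).
  by rewrite ler_wpM2r ?powR_ge0 // lerDl.
by rewrite mulrC -ltr_pdivlMr.
Qed.

Lemma holder_bcont phi : holder alpha phi -> bcont phi.
Proof. by move=> /holder_hbound[A]; apply: hbound_bcont. Qed.

Lemma cnorm_le_supnorm phi : bcont phi -> forall z, cnorm (phi z) <= supnorm phi.
Proof.
move=> [_ [B HB]] z; apply: sup_upper_bound; last by exists z.
split; first by exists (cnorm (phi None)); exists None.
by exists B => _ [u _ <-].
Qed.

(** For a Hoelder function both suprema in [hnorm] run over non-empty bounded sets and are true
    upper bounds. With [hnorm_le] for the way back, estimates pass between the two notions at the
    cost of a factor 2. *)
Lemma hbound_hnorm phi : holder alpha phi -> hbound phi (hnorm alpha phi).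
Proof.
move=> hp; have [A hA] := holder_hbound hp; have bp := hbound_bcont hA.
have A0 := hbound_ge0 hA; have [h1 h2] := hA.
pose S := [set t : R | exists x y, x <> y /\ t = cnorm (phi x - phi y) / (sdist x y `^ alpha)].
have dpos x y : x <> y -> 0 < sdist x y `^ alpha.
  by move=> xy; rewrite powR_gt0 // sdist_gt0.
have hS : has_sup S.
  split.
    exists (cnorm (phi None - phi (Some 0)) / (sdist None (Some 0) `^ alpha)).
    by exists None, (Some 0).
  by exists A => _ [x [y [xy ->]]]; rewrite ler_pdivrMr // dpos.
have S0 : 0 <= sup S.
  apply: (@le_trans _ _ (cnorm (phi None - phi (Some 0)) / (sdist None (Some 0) `^ alpha))).
    by rewrite divr_ge0 // powR_ge0.
  by apply: sup_upper_bound => //; exists None, (Some 0).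
have s0 : 0 <= supnorm phi by apply: le_trans (cnorm_le_supnorm bp None).
have HS x y : cnorm (phi x - phi y) <= sup S * sdist x y `^ alpha.
  have [->|/eqP xy] := eqVneq x y.
    by rewrite subrr cnorm0 mulr_ge0 // powR_ge0.
  rewrite -ler_pdivrMr ?dpos //; apply: sup_upper_bound => //; by exists x, y.
rewrite /hnorm -/S; split => [z|x y].
  by apply: (le_trans (cnorm_le_supnorm bp z)); rewrite lerDl.
by apply: (le_trans (HS x y)); rewrite ler_wpM2r ?powR_ge0 // lerDr.
Qed.

Lemma hnorm_ge0 phi : holder alpha phi -> 0 <= hnorm alpha phi.
Proof. by move=> /hbound_hnorm/hbound_ge0. Qed.

Lemma hnorm_le phi A : hbound phi A -> hnorm alpha phi <= 2 * A.
Proof.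
move=> [h1 h2]; rewrite (_ : 2 * A = A + A); last by ring.
apply: lerD; apply: sup_le_ub.
- by exists (cnorm (phi None)); exists None.
- by move=> _ [z _ <-].
- exists (cnorm (phi None - phi (Some 0)) / (sdist None (Some 0) `^ alpha)).
  by exists None, (Some 0).
- move=> _ [x [y [xy ->]]]; rewrite ler_pdivrMr //.
  by rewrite powR_gt0 // sdist_gt0.
Qed.

(** Almost every g satisfies d(gx,gy) <= L d(x,y), so phi o g has Hoelder constant at most A
    L^alpha. *)
Lemma Mtau_hbound (tau : probability (RatM R) R) : compact_supp tau ->
  exists2 C : R, 0 < C & forall phi A, hbound phi A -> hbound (Mtau tau phi) (C * A).
Proof.
move=> /supp_lipschitz[L L0 [U mU [tU HU]]].
exists (2 * (L `^ alpha + 1)).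
  by rewrite mulr_gt0 // ltr_wpDl // powR_ge0.
move=> phi A hA; have bp := hbound_bcont hA; have A0 := hbound_ge0 hA.
case: hA => [h1 h2]; split => [z|x y].
  apply: (le_trans (Mtau_bound tau A0 bp h1 z)); rewrite -mulrA ler_pM2l //.
  by rewrite ler_peMl // lerDr powR_ge0.
apply: (@le_trans _ _ (2 * (L `^ alpha * A * sdist x y `^ alpha))).
  apply: (Mtau_ae_diff mU tU) => //.
    by rewrite !mulr_ge0 // powR_ge0.
  move=> g /HU Lg; apply: (le_trans (h2 _ _)).
  rewrite (mulrC (L `^ alpha)) -mulrA ler_wpM2l // -powRM ?sdist_ge0 //.
  apply: ge0_ler_powR; rewrite ?nnegrE ?(ltW alpha_gt0) ?mulr_ge0 ?sdist_ge0 //.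
  exact: Lg.
rewrite -!mulrA ler_pM2l // ler_wpM2r ?mulr_ge0 ?powR_ge0 //.
by rewrite lerDl.
Qed.

End HolderSpace.

(** * Exponential sums and Cesaro means *)

Section ExponentialSums.
Variable R : realType.
Implicit Types (a c : nat -> R[i]) (s : nat -> R[i]).

Definition tends0 s := forall e : R, 0 < e -> exists k0, forall k, (k0 <= k)%N -> cnorm (s k) < e.

Definition expsum n c a (k : nat) : R[i] := \sum_(i < n) c i * a i ^+ k.

(** The shift minus [a n] removes the last frequency and multiplies each remaining coefficient by a
    nonzero constant or, for a repeated frequency, by 0. It drives the inductions below. *)
Lemma expsum_shift n c a k :
  expsum n.+1 c a k.+1 - a n * expsum n.+1 c a k
  = expsum n (fun i => c i * (a i - a n)) a k.
Proof.
rewrite /expsum !big_ord_recr /= mulrDr opprD addrACA mulr_sumr -sumrB.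
rewrite [X in _ + X](_ : _ = 0) ?addr0; last by rewrite exprS; ring.
by apply: eq_bigr => i _; rewrite exprS; ring.
Qed.

(** By induction the shift minus the last frequency annihilates the sequence, which is then
    geometric with unimodular ratio: its modulus is constant and tends to 0. *)
Lemma expsum_tends0 n c a : (forall i, (i < n)%N -> cnorm (a i) = 1) ->
  tends0 (expsum n c a) -> forall k, expsum n c a k = 0.
Proof.
elim: n c => [|n IH] c a1 H k; first by rewrite /expsum big_ord0.
have an1 : cnorm (a n) = 1 by apply: a1.
have E j : expsum n.+1 c a j.+1 = a n * expsum n.+1 c a j.
  apply/eqP; rewrite -subr_eq0 expsum_shift; apply/eqP; apply: IH.
    by move=> i /ltnW; exact: a1.
  move=> e e0; have e2 : 0 < e / 2 by lra.
  have [k0 H0] := H _ e2; exists k0 => i ki; rewrite -expsum_shift.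
  apply: (le_lt_trans (cnormD _ _)); rewrite cnormN cnormM an1 mul1r.
  by have := H0 i ki; have := H0 i.+1 (leqW ki); lra.
have N j : cnorm (expsum n.+1 c a j) = cnorm (expsum n.+1 c a 0).
  by elim: j => // j IHj; rewrite E cnormM an1 mul1r.
apply/eqP; rewrite -cnorm_eq0 eq_le cnorm_ge0 andbT N.
rewrite leNgt; apply/negP => pos; have [k0 /(_ k0 (leqnn _))] := H _ pos.
by rewrite N ltxx.
Qed.

Lemma expsum_inj n c a (zeta x : R[i]) : (forall i, (i < n)%N -> a i != zeta) ->
  (forall k, expsum n c a k = zeta ^+ k * x) -> x = 0.
Proof.
elim: n c x => [|n IH] c x az H.
  by have := H 0%N; rewrite /expsum big_ord0 expr0 mul1r.
have /eqP : (zeta - a n) * x = 0.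
  apply: (IH (fun i => c i * (a i - a n))) => [i /ltnW|k]; first exact: az.
  by rewrite -expsum_shift !H exprS; ring.
by rewrite mulf_eq0 subr_eq0 eq_sym (negbTE (az n (ltnSn n))) /= => /eqP.
Qed.

(* Cesaro boundedness: the averages of s are asymptotically at most e. *)
Definition cesaro_le s (e : R) := exists C : R, forall J : nat,
  cnorm (\sum_(j < J) s j) <= e * J%:R + C.

Lemma cesaro_leD s t e f : cesaro_le s e -> cesaro_le t f ->
  cesaro_le (fun j => s j + t j) (e + f).
Proof.
move=> [C HC] [D HD]; exists (C + D) => J; rewrite big_split /=.
by apply: (le_trans (cnormD _ _)); have := HC J; have := HD J; lra.
Qed.

Lemma cesaro_le_geometric (u w : R[i]) : cnorm w = 1 -> w != 1 ->
  cesaro_le (fun j => u * w ^+ j) 0.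
Proof.
move=> w1 w_neq1; exists (cnorm u * (2 / cnorm (w - 1))) => J.
rewrite mul0r add0r -mulr_sumr cnormM ler_wpM2l //.
have n0 : 0 < cnorm (w - 1) by rewrite cnorm_gt0 subr_eq0.
rewrite ler_pdivlMr // mulrC -cnormM -subrX1.
by apply: (le_trans (cnormD _ _)); rewrite cnormN cnorm1 cnormX w1 expr1n.
Qed.

(** Multiplication by w^(-j) turns w into the zero frequency. The frequency w is tolerated where its
    coefficient is 0, so a term can be deleted from a sum without renumbering. *)
Lemma cesaro_le_expsum n c a (w : R[i]) : cnorm w = 1 ->
  (forall i, (i < n)%N -> cnorm (a i) = 1 /\ (c i != 0 -> a i != w)) ->
  cesaro_le (fun j => w ^- j * expsum n c a j) 0.
Proof.
move=> w1; have w0 : w != 0 by rewrite -cnorm_gt0 w1.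
elim: n => [|n IH] H.
  exists 0 => J; rewrite big1 ?cnorm0 ?mul0r ?addr0 // => j _.
  by rewrite /expsum big_ord0 mulr0.
have -> : (fun j => w ^- j * expsum n.+1 c a j) =
  (fun j => w ^- j * expsum n c a j + c n * (a n / w) ^+ j).
  apply: funext => j; rewrite /expsum big_ord_recr /= mulrDr; congr (_ + _).
  by rewrite expr_div_n; ring.
rewrite -[X in cesaro_le _ X]addr0; apply: cesaro_leD.
  by apply: IH => i /ltnW; exact: H.
have [a1 aw] := H n (ltnSn n); have [->|cn0] := eqVneq (c n) 0.
  by exists 0 => J; rewrite big1 ?cnorm0 ?mul0r ?addr0 // => j _; rewrite mul0r.
apply: cesaro_le_geometric.
  by rewrite cnormM cnormV a1 w1 invr1 mulr1.
by apply: contra (aw cn0) => /eqP h; rewrite -[a n](divfK w0) h mul1r.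
Qed.

Lemma cesaro_le_eventually s (e : R) j0 : 0 <= e ->
  (forall j, (j0 <= j)%N -> cnorm (s j) <= e) -> cesaro_le s e.
Proof.
move=> e0 H; exists (\sum_(j < j0) cnorm (s j)) => J.
apply: (le_trans (cnorm_sum _ _ _)).
rewrite -!(big_mkord predT (fun j => cnorm (s j))).
elim: J => [|J IH].
  by rewrite big_geq // mulr0 add0r sumr_ge0.
rewrite big_nat_recr //=; have [h|h] := leqP j0 J.
  by rewrite -natr1; have := H _ h; lra.
rewrite -big_nat_recr //= (big_cat_nat _ h) //=.
apply: (@le_trans _ _ (\sum_(0 <= i < J.+1) cnorm (s i) + \sum_(J.+1 <= i < j0) cnorm (s i))).
  by rewrite lerDl sumr_ge0.
by rewrite lerDr mulr_ge0.
Qed.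

Lemma cesaro_le_cst (u : R[i]) (e : R) : cesaro_le (fun=> u) e -> cnorm u <= e.
Proof.
move=> [C HC]; rewrite leNgt; apply/negP => ue.
pose J := (Num.truncn (C / (cnorm u - e))).+1.
have d0 : 0 < cnorm u - e by rewrite subr_gt0.
have := HC J; rewrite sumr_const card_ord -[u *+ J]mulr_natr cnormM.
have -> : cnorm (J%:R : R[i]) = J%:R.
  by rewrite -[J%:R](rmorph_nat (real_complex R)) cnorm_real ger0_norm.
apply/negP; rewrite -ltNge.
have : C / (cnorm u - e) < J%:R by exact: truncnS_gt.
by rewrite ltr_pdivrMr //; lra.
Qed.

End ExponentialSums.

(** * Scalar series with geometric majorant *)

Section GeometricSeries.
Variable R : realType.

Lemma geometric_tends0 (B r e : R) : 0 <= r < 1 -> 0 < e ->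
  exists N0, forall N, (N0 <= N)%N -> B * r ^+ N < e.
Proof.
move=> /andP[r0 r1] e0.
have : (fun N => B * r ^+ N) @ \oo --> (0 : R).
  by apply: cvg_geometric; rewrite ger0_norm.
move/cvgrPdist_lt => /(_ e e0) [N0 _ H]; exists N0 => N NN.
have := H N NN; rewrite sub0r normrN; apply: le_lt_trans; exact: ler_norm.
Qed.

Lemma le_geometric_limit (x y B r : R) (N0 : nat) : 0 <= r < 1 ->
  (forall N, (N0 <= N)%N -> x <= y + B * r ^+ N) -> x <= y.
Proof.
move=> r01 H; rewrite leNgt; apply/negP => yx.
have [|N1 H1] := geometric_tends0 B r01 (_ : 0 < x - y); first by rewrite subr_gt0.
have := H _ (leq_maxl N0 N1); have := H1 _ (leq_maxr N0 N1); lra.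
Qed.

(** The limit is delivered through an explicit tail estimate, the form that makes later bounds
    uniform in the point and in the function. *)
Lemma real_geometric_series (u : nat -> R) (A r : R) : 0 <= A -> 0 <= r < 1 ->
  (forall n, `|u n| <= A * r ^+ n) ->
  exists l : R, forall N, `|l - \sum_(n < N) u n| <= A * r ^+ N / (1 - r).
Proof.
move=> A0 /[dup] r01 /andP[r0 r1] H; have d0 : 0 < 1 - r by lra.
have partial N M : (N <= M)%N ->
    `|\sum_(n < M) u n - \sum_(n < N) u n| <= A * r ^+ N / (1 - r).
  move=> NM; rewrite -!(big_mkord predT u) (big_cat_nat _ NM) //= addrAC subrr add0r.
  rewrite -(subnKC NM) -{1}[N]add0n big_addn addKn.
  move: (M - N)%N => m {NM}; elim: m N => [|m IH] N.
    by rewrite big_geq // normr0 divr_ge0 ?mulr_ge0 ?exprn_ge0 // ltW.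
  rewrite big_nat_recl //=; apply: (le_trans (ler_normD _ _)).
  rewrite add0n; under eq_bigr do rewrite addSnnS.
  have := IH N.+1; have := H N.
  have -> : A * r ^+ N / (1 - r) = A * r ^+ N + A * r ^+ N.+1 / (1 - r).
    by rewrite exprS; field; rewrite gt_eqF.
  lra.
have cs : cvg (series u @ \oo).
  apply: normed_cvg; apply: (series_le_cvg (v_ := fun n => A * r ^+ n)) => //.
  - by move=> n /=; exact: normr_ge0.
  - by move=> n; rewrite mulr_ge0 // exprn_ge0.
  - by apply: is_cvg_geometric_series; rewrite ger0_norm.
exists (limn (series u)) => N.
have h : (fun M => `|series u M - \sum_(n < N) u n|) @ \oo
     --> `|limn (series u) - \sum_(n < N) u n|.
  by apply: cvg_norm; apply: cvgB => //; exact: cvg_cst.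
rewrite -(cvg_lim _ h) //; apply: limr_le; first by apply: cvgP h.
by exists N => // M /= NM; rewrite /series /= big_mkord; exact: partial.
Qed.

End GeometricSeries.

(** * Series of complex numbers and of Hoelder functions *)

Section FunctionSeries.
Variables (R : realType) (alpha : R).
Implicit Types (x y z : sphere R).

Lemma geometric_limit_unique (s : nat -> R[i]) (l l' : R[i]) (B B' r : R) : 0 <= r < 1 ->
  (forall N, cnorm (l - s N) <= B * r ^+ N) ->
  (forall N, cnorm (l' - s N) <= B' * r ^+ N) -> l = l'.
Proof.
move=> r01 H H'; apply/eqP; rewrite -subr_eq0 -cnorm_eq0 eq_le cnorm_ge0 andbT.
apply: (@le_geometric_limit _ _ _ (B + B') r 0) => // N _; rewrite add0r.
have -> : l - l' = (l - s N) - (l' - s N) by ring.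
by apply: (le_trans (cnormD _ _)); rewrite cnormN; have := H N; have := H' N; lra.
Qed.

Lemma complex_geometric_series (u : nat -> R[i]) (A r : R) : 0 <= A -> 0 <= r < 1 ->
  (forall n, cnorm (u n) <= A * r ^+ n) ->
  exists l : R[i], forall N, cnorm (l - \sum_(n < N) u n) <= 2 * (A / (1 - r)) * r ^+ N.
Proof.
move=> A0 r01 H.
have [a Ha] := real_geometric_series A0 r01 (fun n => le_trans (cnorm_Re (u n)) (H n)).
have [b Hb] := real_geometric_series A0 r01 (fun n => le_trans (cnorm_Im (u n)) (H n)).
exists (Complex a b) => N; apply: (le_trans (cnorm_ReIm _)).
have E : \sum_(n < N) u n =
    Complex (\sum_(n < N) complex.Re (u n)) (\sum_(n < N) complex.Im (u n)).
  elim/big_rec3: _ => [|i y1 y2 y3 _ ->] //; by case: (u i).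
rewrite E /=; have := Ha N; have := Hb N.
by rewrite (mulrAC A) => h1 h2; rewrite -mulrA; lra.
Qed.

(** The completeness of C^alpha needed for the Neumann series. The seminorm of the tail is obtained
    by summing the differences u_n(x) - u_n(y), which have the majorant A d(x,y)^alpha r^n, and
    identifying the sum with S(x) - S(y). *)
Lemma holder_geometric_series (u : nat -> sphere R -> R[i]) (A r : R) :
  0 <= A -> 0 <= r < 1 -> (forall n, hbound alpha (u n) (A * r ^+ n)) ->
  exists S : sphere R -> R[i], forall N,
    hbound alpha (fun z => S z - \sum_(n < N) u n z) (2 * (A / (1 - r)) * r ^+ N).
Proof.
move=> A0 r01 H.
have [S HS] := choice (fun z => complex_geometric_series A0 r01 (fun n => (H n).1 z)).
exists S => N; split => [z|x y]; first exact: HS.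
have B0 : 0 <= A * sdist x y `^ alpha by rewrite mulr_ge0 // powR_ge0.
have [|l Hl] := @complex_geometric_series (fun n => u n x - u n y) _ r B0 r01.
  by move=> n; rewrite mulrAC; exact: (H n).2.
have E : l = S x - S y.
  apply: (geometric_limit_unique r01 Hl) => {}N.
  rewrite sumrB; have -> : S x - S y - (\sum_(n < N) u n x - \sum_(n < N) u n y) =
    (S x - \sum_(n < N) u n x) - (S y - \sum_(n < N) u n y) by ring.
  apply: (le_trans (cnormD _ _)); rewrite cnormN.
  apply: (le_trans (lerD (HS x N) (HS y N))); rewrite -mulrDl; exact: lexx.
have := Hl N; rewrite E sumrB.
have -> : S x - S y - (\sum_(n < N) u n x - \sum_(n < N) u n y) =
    S x - \sum_(n < N) u n x - (S y - \sum_(n < N) u n y) by ring.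
by move/le_trans; apply; rewrite le_eqVlt; apply/orP; left; apply/eqP; ring.
Qed.

End FunctionSeries.

(** * Span of the unimodular eigenfunctions and finiteness of the eigenvalues *)

Section PeripheralSpectrum.
Variables (R : realType) (tau : probability (RatM R) R) (alpha : R).
Hypothesis alpha_gt0 : 0 < alpha.
Hypothesis tau_compact : compact_supp tau.
Hypothesis LS_holder : LS (Uf tau) `<=` holder alpha.
Implicit Types (x y z : sphere R) (phi psi : sphere R -> R[i]).

Local Notation M := (Mtau tau).
Local Notation Mn := (Mtau_n tau).

Lemma MtauB phi psi : bcont phi -> bcont psi ->
  M (fun z => phi z - psi z) = (fun z => M phi z - M psi z).
Proof.
move=> bp bq; have := MtauD tau bp (bcontZ (-1) bq); rewrite MtauZ // => E.
rewrite [RHS](_ : _ = (fun z => M phi z + -1 * M psi z)).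
  by rewrite -E; congr M; apply: funext => z; rewrite mulN1r.
by apply: funext => z; rewrite mulN1r.
Qed.

Lemma holder_Mtau phi : holder alpha phi -> holder alpha (M phi).
Proof.
move=> /(holder_hbound alpha_gt0)[A hA].
have [C _ HC] := Mtau_hbound alpha_gt0 tau_compact.
exact: hbound_holder (HC _ _ hA).
Qed.

Lemma holder_Mtau_n n phi : holder alpha phi -> holder alpha (Mn n phi).
Proof. by move=> hp; elim: n => //= n IH; exact: holder_Mtau. Qed.

Lemma holder_lin a b phi psi : holder alpha phi -> holder alpha psi ->
  holder alpha (fun z => a * phi z + b * psi z).
Proof.
move=> /(holder_hbound alpha_gt0)[A hA] /(holder_hbound alpha_gt0)[B hB].
exact: hbound_holder (hboundD (hboundZ a hA) (hboundZ b hB)).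
Qed.

Lemma holderB phi psi : holder alpha phi -> holder alpha psi ->
  holder alpha (fun z => phi z - psi z).
Proof.
move=> /(holder_hbound alpha_gt0)[A hA] /(holder_hbound alpha_gt0)[B hB].
exact: hbound_holder (hboundB hA hB).
Qed.

Lemma holderZ a phi : holder alpha phi -> holder alpha (fun z => a * phi z).
Proof.
move=> /(holder_hbound alpha_gt0)[A hA]; exact: hbound_holder (hboundZ a hA).
Qed.

Lemma holder_sum n (f : nat -> sphere R -> R[i]) (c : nat -> R[i]) :
  (forall i, (i < n)%N -> holder alpha (f i)) ->
  holder alpha (fun z => \sum_(i < n) c i * f i z).
Proof.
elim: n => [|n IH] H.
  exists 0 => x y; rewrite !big_ord0 subrr cnorm0 mul0r; exact: lexx.
have -> : (fun z => \sum_(i < n.+1) c i * f i z) =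
  (fun z => 1 * (\sum_(i < n) c i * f i z) + c n * f n z).
  by apply: funext => z; rewrite big_ord_recr mul1r.
by apply: holder_lin; [apply: IH => i /ltnW|]; exact: H.
Qed.

Lemma Mtau_sum n (f : nat -> sphere R -> R[i]) (c : nat -> R[i]) :
  (forall i, (i < n)%N -> holder alpha (f i)) ->
  M (fun z => \sum_(i < n) c i * f i z) = (fun z => \sum_(i < n) c i * M (f i) z).
Proof.
elim: n => [|n IH] H.
  have -> : (fun z : sphere R => \sum_(i < 0) c i * f i z) = (fun z => 0 * f 0%N z).
    by apply: funext => z; rewrite big_ord0 mul0r.
  apply: funext => z; rewrite big_ord0 /Mtau /cint.
  have E0 : Rintegral tau setT (fun=> 0) = 0 :> R.
    by rewrite Rintegral_cst // mul0r.
  apply/eqP; rewrite eq_complex /=; apply/andP; split; apply/eqP;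
    rewrite -[RHS]E0; apply: eq_Rintegral => g _; by rewrite mul0r.
have Hn i : (i < n)%N -> holder alpha (f i) by move/ltnW; exact: H.
have -> : (fun z => \sum_(i < n.+1) c i * f i z) =
  (fun z => (\sum_(i < n) c i * f i z) + c n * f n z).
  by apply: funext => z; rewrite big_ord_recr.
have bn : bcont (f n) by apply: (holder_bcont alpha_gt0); exact: H.
rewrite MtauD; [|by apply: (holder_bcont alpha_gt0); exact: holder_sum|exact: bcontZ].
by rewrite IH // MtauZ //; apply: funext => z; rewrite big_ord_recr.
Qed.

Definition eigen_family n (a : nat -> R[i]) (f : nat -> sphere R -> R[i]) :=
  forall i, (i < n)%N -> [/\ cnorm (a i) = 1, Uv tau (a i), Uf tau (f i),
    holder alpha (f i) & M (f i) = (fun z => a i * f i z)].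

Lemma Uf_holder phi : Uf tau phi -> holder alpha phi.
Proof.
move=> Up; apply: LS_holder; exists 1%N, (fun=> 1), (fun=> phi); split=> //.
by apply: funext => z; rewrite big_ord1 mul1r.
Qed.

Lemma LS_eigen psi : LS (Uf tau) psi -> exists (n : nat) (c a : nat -> R[i]) f,
  eigen_family n a f /\ psi = (fun z => \sum_(i < n) c i * f i z).
Proof.
move=> [n [c [f [Hf ->]]]].
have : forall i, exists a, (i < n)%N -> [/\ cnorm a = 1, Uv tau a, Uf tau (f i),
    holder alpha (f i) & M (f i) = (fun z => a * f i z)].
  move=> i; have [/Hf Ufi|_] := ltnP i n; last by exists 0.
  have hf := Uf_holder Ufi; case: (Ufi) => cf nf [a [a1 E]].
  by exists a => _; split => //; split => //; exists (f i).
by move=> /choice[a Ha]; exists n, c, a, f.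
Qed.

Lemma eigen_LS n a f (c : nat -> R[i]) : eigen_family n a f ->
  LS (Uf tau) (fun z => \sum_(i < n) c i * f i z).
Proof. by move=> H; exists n, c, f; split => // i /H[]. Qed.

Lemma eigen_Mtau n a f (c : nat -> R[i]) : eigen_family n a f ->
  M (fun z => \sum_(i < n) c i * f i z) = (fun z => \sum_(i < n) (c i * a i) * f i z).
Proof.
move=> H; rewrite Mtau_sum => [|i /H[]//]; apply: funext => z.
by apply: eq_bigr => i _; have [_ _ _ _ ->] := H i (ltn_ord i); rewrite mulrA.
Qed.

Lemma eigen_Mtau_n n a f (c : nat -> R[i]) k : eigen_family n a f ->
  Mn k (fun z => \sum_(i < n) c i * f i z) =
  (fun z => expsum n (fun i => c i * f i z) a k).
Proof.
move=> H; have -> : (fun z => expsum n (fun i => c i * f i z) a k) =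
    (fun z => \sum_(i < n) (c i * a i ^+ k) * f i z).
  by apply: funext => z; apply: eq_bigr => i _; rewrite mulrAC.
elim: k => [|k IH] /=.
  by apply: funext => z; apply: eq_bigr => i _; rewrite expr0 mulr1.
rewrite -/(Mn k) IH (eigen_Mtau (fun i => c i * a i ^+ k) H); apply: funext => z.
by apply: eq_bigr => i _; rewrite exprSr mulrA.
Qed.

Lemma LS_Mtau psi : LS (Uf tau) psi -> LS (Uf tau) (M psi).
Proof.
move=> /LS_eigen[n [c [a [f [H ->]]]]]; rewrite (eigen_Mtau _ H).
exact: (eigen_LS (fun i => c i * a i) H).
Qed.

(** Pointwise decay suffices: at a fixed point, the iterates of an element of [LS (Uf tau)] form a
    scalar exponential sum. *)
Definition ptzero phi := forall z, tends0 (fun k => Mn k phi z).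

Lemma LS_ptzero psi : LS (Uf tau) psi -> ptzero psi -> psi = (fun=> 0).
Proof.
move=> /LS_eigen[n [c [a [f [H ->]]]]] Hz; apply: funext => z.
have := Hz z; have -> : (fun k => Mn k (fun w => \sum_(i < n) c i * f i w) z) =
    expsum n (fun i => c i * f i z) a.
  by apply: funext => k; rewrite (eigen_Mtau_n _ _ H).
move=> Ht; have := expsum_tends0 _ Ht 0%N; rewrite /expsum => E.
have {}E := E (fun i ni => let: And5 h _ _ _ _ := H i ni in h).
by rewrite -[RHS]E; apply: eq_bigr => i _; rewrite expr0 mulr1.
Qed.

(** At each point zeta^k psi(z) is an exponential sum whose frequencies lie in [Uv tau] and so
    differ from zeta. The argument is algebraic and puts no condition on |zeta|. *)
Lemma LS_eigen_zero zeta psi : ~ Uv tau zeta -> LS (Uf tau) psi ->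
  M psi = (fun z => zeta * psi z) -> psi = (fun=> 0).
Proof.
move=> nz Epsi Mpsi; have hpsi := LS_holder Epsi.
have MnE k : Mn k psi = (fun z => zeta ^+ k * psi z).
  elim: k => [|k IH] /=; first by apply: funext => z; rewrite expr0 mul1r.
  rewrite -/(Mn k) IH MtauZ; last exact: (holder_bcont alpha_gt0).
  by rewrite Mpsi; apply: funext => z; rewrite exprSr mulrA.
have [n [c [a [f [H E]]]]] := LS_eigen Epsi.
apply: funext => z; apply: (@expsum_inj _ n (fun i => c i * f i z) a zeta).
  by move=> i /H[_ Ua _ _ _]; apply/eqP => az; apply: nz; rewrite -az.
by move=> k; rewrite -[RHS](congr1 (fun h => h z) (MnE k)) E (eigen_Mtau_n _ _ H).
Qed.


Variable prj : (sphere R -> R[i]) -> sphere R -> R[i].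
Hypothesis prj_tau : is_pi_tau tau prj.

Lemma unit_eigenfunction a : Uv tau a -> exists f, [/\ holder alpha f,
  exists z, f z != 0, forall z, cnorm (f z) <= 1 & M f = (fun z => a * f z)].
Proof.
move=> [a1 [f [cf nf Mf]]].
have hf : holder alpha f by apply: Uf_holder; split => //; exists a.
have [A hA] := holder_hbound alpha_gt0 hf.
have bf := hbound_bcont alpha_gt0 hA; have A0 := hbound_ge0 hA.
have A1 : 0 < A + 1 by lra.
have z0 : exists z, f z != 0.
  apply: contrapT => H; apply: nf; apply: funext => z; apply/eqP.
  by apply: contrapT => /negP h; apply: H; exists z.
pose c : R[i] := ((A + 1)^-1)%:C.
have nc : cnorm c = (A + 1)^-1 by rewrite cnorm_real ger0_norm // invr_ge0 ltW.
exists (fun z => c * f z); split.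
- exact: holderZ.
- case: z0 => z fz; exists z; rewrite mulf_neq0 // -cnorm_gt0 nc invr_gt0 //.
- move=> z; rewrite cnormM nc ler_pdivrMl // mulr1.
  by apply: (le_trans (hA.1 z)); rewrite lerDl.
- by rewrite MtauZ // Mf; apply: funext => z; ring.
Qed.

Lemma uniform_limit_bcont (F : sphere R -> R[i]) (G : nat -> sphere R -> R[i]) (B r : R) :
  0 <= r < 1 -> (forall N, bcont (G N)) ->
  (forall N z, cnorm (F z - G N z) <= B * r ^+ N) -> bcont F.
Proof.
move=> r01 bG H; split; last first.
  have [_ [A HA]] := bG 0%N; exists (B + A) => z.
  rewrite -[F z](subrK (G 0%N z)); apply: (le_trans (cnormD _ _)).
  by rewrite lerD //; have := H 0%N z; rewrite expr0 mulr1.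
move=> z e e0; have e3 : 0 < e / 3 by lra.
have [N0 HN0] := geometric_tends0 B r01 e3.
have hN w := le_lt_trans (H N0 w) (HN0 _ (leqnn _)).
have [d d0 Hd] := (bG N0).1 z _ e3; exists d => // w /Hd h.
have -> : F w - F z = (F w - G N0 w) + (G N0 w - G N0 z) - (F z - G N0 z) by ring.
apply: (le_lt_trans (cnormD _ _)); rewrite cnormN.
have := cnormD (F w - G N0 w) (G N0 w - G N0 z); have := hN w; have := hN z; lra.
Qed.

(* If there were infinitely many unimodular eigenvalues, a uniformly convergent
   series of eigenfunctions would be a continuous function with infinitely many
   nonzero frequencies, whereas its projection has finitely many. *)
Lemma Uv_finite : finite_set (Uv tau).
Proof.
apply: contrapT => /infiniteP/card_leP/unsquash i.
pose nat_in (k : nat) : [set: nat] := exist _ k (mem_set I).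
pose a (k : nat) : R[i] := val (i (nat_in k)).
have aU k : Uv tau (a k) by exact: set_valP.
have a1 k : cnorm (a k) = 1 by have [] := aU k.
have ainj : injective a.
  move=> k l /val_inj E; have := @inj _ _ _ i (nat_in k) (nat_in l).
  by rewrite !inE => /(_ I I E)/(congr1 val).
have [f Hf] := choice (fun k => unit_eigenfunction (aU k)).
pose r : R := 2^-1; have r01 : 0 <= r < 1 by rewrite /r; lra.
pose B : R := 2 * (1 / (1 - r)).
pose v (k : nat) : R[i] := (r ^+ k)%:C.
have nv k : cnorm (v k) = r ^+ k by rewrite cnorm_real ger0_norm // exprn_ge0 //; lra.
have ser (jz : nat * sphere R) : exists l, forall N,
    cnorm (l - \sum_(k < N) (v k * a k ^+ jz.1) * f k jz.2) <= B * r ^+ N.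
  apply: (@complex_geometric_series R (fun k => v k * a k ^+ jz.1 * f k jz.2)) => // k.
  rewrite !cnormM nv cnormX a1 expr1n mulr1 mul1r ler_piMr //.
    by rewrite exprn_ge0 //; lra.
  by have [] := Hf k.
have [Psi HPsi] := choice ser.
(* The sum over k of 2^(-k) a_k^j f_k, which is to be the j-th iterate of [psi 0]. All j are
   constructed at once, and [Mpsi] then links them. *)
pose psi j z := Psi (j, z).
pose T j N z := \sum_(k < N) (v k * a k ^+ j) * f k z.
have Hpsi j N z : cnorm (psi j z - T j N z) <= B * r ^+ N by exact: (HPsi (j, z) N).
have hT j N : holder alpha (T j N).
  by apply: (@holder_sum N f (fun k => v k * a k ^+ j)) => k _; have [] := Hf k.
have bT j N := holder_bcont alpha_gt0 (hT j N).
have bpsi j : bcont (psi j) by apply: (uniform_limit_bcont r01 (bT j) (Hpsi j)).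
have MT j N : M (T j N) = T j.+1 N.
  rewrite (@Mtau_sum N f (fun k => v k * a k ^+ j)); last by move=> k _; have [] := Hf k.
  apply: funext => z; apply: eq_bigr => k _; have [_ _ _ ->] := Hf k.
  by rewrite exprSr; ring.
have B0 : 0 <= B by rewrite /B mulr_ge0 // divr_ge0 // /r; lra.
(* [M] takes the partial sums of [psi j] to those of [psi j.+1], and its sup bound preserves the
   geometric error; both sides are limits of the same sequence. *)
have Mpsi j : M (psi j) = psi j.+1.
  apply: funext => z; apply: (@geometric_limit_unique _ (fun N => T j.+1 N z) _ _ (2 * B) B r) => //.
  move=> N; rewrite -MT -(congr1 (fun h => h z) (MtauB (bpsi j) (bT j N))) -mulrA.
  apply: Mtau_bound => //; first by rewrite mulr_ge0 // exprn_ge0 //; lra.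
  have := bcontD (bpsi j) (bcontZ (-1) (bT j N)); congr bcont.
  by apply: funext => w; rewrite mulN1r.
have Mnpsi k : Mn k (psi 0%N) = psi k by elim: k => //= k; rewrite -/(Mn k) => ->.
have [LSp [_ Hdec]] := prj_tau (bpsi 0%N).1.
have [n [c [b [h [Hh Ep]]]]] := LS_eigen LSp.
have hp := LS_holder LSp; have bp := holder_bcont alpha_gt0 hp.
have Mnd k : Mn k (fun z => psi 0%N z - prj (psi 0%N) z) =
    (fun z => psi k z - Mn k (prj (psi 0%N)) z).
  elim: k => //= k; rewrite -/(Mn k) => ->; rewrite MtauB ?Mpsi //.
  by apply: (holder_bcont alpha_gt0); exact: holder_Mtau_n.
(* Pigeonhole: the projection has n frequencies, and the [a k] are pairwise distinct. *)
have [k0 Hk0] : exists k0, forall i, (i < n)%N -> b i != a k0.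
  apply: contrapT => H.
  have sub : {subset map a (iota 0 n.+1) <= map b (iota 0 n)}.
    move=> _ /mapP[k _ ->]; apply: contrapT => /negP ak; apply: H; exists k => j jn.
    by apply: contra ak => /eqP <-; apply: map_f; rewrite mem_iota.
  have := uniq_leq_size _ sub; rewrite map_inj_uniq // iota_uniq => /(_ isT).
  by rewrite !size_map !size_iota ltnn.
have [_ [z fz] _ _] := Hf k0.
pose w := a k0; have w1 : cnorm w = 1 by exact: a1.
pose u := v k0 * f k0 z.
have u0 : 0 < cnorm u.
  by rewrite cnorm_gt0 mulf_neq0 // -cnorm_gt0 nv exprn_gt0 // /r; lra.
(* The decaying part and the tail of the series contribute e each, so the averages of the constant u
   would be at most |u| / 2. *)
pose e := cnorm u / 4; have e0 : 0 < e by rewrite /e; lra.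
have [N0 HN0] := geometric_tends0 B r01 e0.
pose N := maxn N0 k0.+1; have k0N : (k0 < N)%N by rewrite /N leq_maxr.
have tail j : cnorm (psi j z - T j N z) < e.
  by apply: (le_lt_trans (Hpsi j N z)); apply: HN0; rewrite leq_maxl.
pose s j := Mn j (fun x => psi 0%N x - prj (psi 0%N) x) z.
have s0 : tends0 s.
  move=> d d0; move/cvgrPdist_lt: Hdec => /(_ d d0)[j0 _ Hj0]; exists j0 => j /Hj0 /=.
  rewrite sub0r normrN => Hj; apply: le_lt_trans Hj; apply: le_trans (ler_norm _).
  apply: (@cnorm_le_supnorm R (Mn j (fun x => psi 0%N x - prj (psi 0%N) x))).
  rewrite Mnd; have bM := holder_bcont alpha_gt0 (holder_Mtau_n j hp).
  have := bcontD (bpsi j) (bcontZ (-1) bM); congr bcont.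
  by apply: funext => x; rewrite mulN1r.
have [j0 Hj0] := s0 _ e0.
have w0 : w != 0 by rewrite -cnorm_gt0 w1.
have nwj j : cnorm (w ^- j) = 1 by rewrite cnormV cnormX w1 expr1n invr1.
pose c' (k : nat) := if k == k0 then 0 else v k * f k z.
(* The coefficient u of the frequency w is isolated by w^(-j). There remain the decaying part minus
   the tail, the projection, which lacks w, and the partial sum with w deleted; the last two have
   averages tending to 0. *)
have Eu : (fun=> u) = (fun j => (w ^- j * (s j - (psi j z - T j N z)) +
    w ^- j * expsum n (fun i => c i * h i z) b j) + - 1 * (w ^- j * expsum N c' a j)).
  apply: funext => j; rewrite /s Mnd Ep (eigen_Mtau_n _ _ Hh).
  have ET : T j N z = u * w ^+ j + expsum N c' a j.
    rewrite /T /expsum (bigD1 (Ordinal k0N)) //= [in RHS](bigD1 (Ordinal k0N)) //=.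
    rewrite /c' eqxx mul0r add0r mulrAC -/u -/w; congr (_ + _).
    apply: eq_bigr => k; rewrite -(inj_eq val_inj) /= => /negbTE ->.
    by rewrite mulrAC.
  by rewrite ET; field; rewrite expf_neq0.
have : cesaro_le (fun=> u) (2 * e + 0 + 0).
  rewrite Eu; apply: cesaro_leD; first apply: cesaro_leD.
  - apply: (@cesaro_le_eventually _ _ _ j0); first by lra.
    move=> j jj; rewrite cnormM nwj mul1r; apply: (le_trans (cnormD _ _)).
    by rewrite cnormN; have := Hj0 j jj; have := tail j; lra.
  - apply: cesaro_le_expsum => // i0 ni; split; last by move=> _; exact: Hk0.
    by have [] := Hh i0 ni.
  - have [|D HD] := @cesaro_le_expsum R N c' a w w1.
      move=> k _; split; first exact: a1.
      by rewrite /c'; have [//|kk _] := eqVneq k k0; [rewrite eqxx|rewrite (inj_eq ainj)].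
    exists D => J; rewrite -mulr_sumr cnormM cnormN cnorm1 mul1r; exact: HD.
by move/cesaro_le_cst; rewrite /e; lra.
Qed.


(** * Construction of the resolvent and its expansion *)

Section Resolvent.
Variables (lambda K : R) (zeta : R[i]).
Hypothesis lambda_gt0 : 0 < lambda.
Hypothesis lambda_lt1 : lambda < 1.
Hypothesis K_ge0 : 0 <= K.
Hypothesis decay : forall phi, holder alpha phi -> forall n : nat,
  hnorm alpha (Mn n (fun z => phi z - prj phi z)) <= K * lambda ^+ n * hnorm alpha phi.
Hypothesis zeta_gt : lambda < cnorm zeta.
Hypothesis zeta_Uv : ~ Uv tau zeta.

Let bc phi : holder alpha phi -> bcont phi := @holder_bcont R alpha alpha_gt0 phi.

Let nz0 : 0 < cnorm zeta. Proof. exact: lt_trans zeta_gt. Qed.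

Let zeta0 : zeta != 0. Proof. by rewrite -cnorm_gt0. Qed.

Definition shifted phi : sphere R -> R[i] := fun z => zeta * phi z - M phi z.

Definition rem phi : sphere R -> R[i] := fun z => phi z - prj phi z.

Lemma prj_LS phi : holder alpha phi -> LS (Uf tau) (prj phi).
Proof. by move=> hp; have [] := prj_tau (bc hp).1. Qed.

Lemma prj_holder phi : holder alpha phi -> holder alpha (prj phi).
Proof. by move=> /prj_LS; exact: LS_holder. Qed.

Lemma rem_holder phi : holder alpha phi -> holder alpha (rem phi).
Proof. by move=> hp; apply: holderB => //; exact: prj_holder. Qed.

Lemma rem_hbound phi n : holder alpha phi ->
  hbound alpha (Mn n (rem phi)) (K * hnorm alpha phi * lambda ^+ n).
Proof.
move=> hp; rewrite mulrAC; apply: hboundW (decay hp n) _.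
by apply: (hbound_hnorm alpha_gt0); apply: holder_Mtau_n; exact: rem_holder.
Qed.

Lemma shifted_D phi psi : holder alpha phi -> holder alpha psi ->
  shifted (fun z => phi z + psi z) = (fun z => shifted phi z + shifted psi z).
Proof. by move=> /bc bp /bc bq; apply: funext => z; rewrite /shifted MtauD //; ring. Qed.

Lemma shifted_Z a phi : holder alpha phi ->
  shifted (fun z => a * phi z) = (fun z => a * shifted phi z).
Proof. by move=> /bc bp; apply: funext => z; rewrite /shifted MtauZ //; ring. Qed.

Lemma shifted_holder phi : holder alpha phi -> holder alpha (shifted phi).
Proof. by move=> hp; apply: holderB; [exact: holderZ|exact: holder_Mtau]. Qed.

Lemma Mtau_n_shifted k phi : holder alpha phi -> Mn k (shifted phi) = shifted (Mn k phi).
Proof.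
move=> hp; elim: k => //= k IH; rewrite -!/(Mn k) IH /shifted.
have hk := holder_Mtau_n k hp.
by rewrite MtauB ?MtauZ //; [apply: bc|apply: bcontZ; apply: bc|apply/bc/holder_Mtau].
Qed.

Lemma Mtau_n_Z k a phi : holder alpha phi ->
  Mn k (fun z => a * phi z) = (fun z => a * Mn k phi z).
Proof.
move=> hp; elim: k => //= k IH; rewrite -!/(Mn k) IH MtauZ //.
by apply: bc; exact: holder_Mtau_n.
Qed.

Lemma shifted_LS psi : LS (Uf tau) psi -> LS (Uf tau) (shifted psi).
Proof.
move=> /LS_eigen[n [c [a [f [H ->]]]]]; rewrite /shifted (eigen_Mtau _ H).
have := eigen_LS (fun i => (zeta - a i) * c i) H; congr (LS _ _).
apply: funext => z; rewrite mulr_sumr -sumrB; apply: eq_bigr => i _; ring.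
Qed.

Let r := lambda / cnorm zeta.
Let r01 : 0 <= r < 1.
Proof. by rewrite divr_ge0 ?ltW //= ltr_pdivrMr // mul1r. Qed.

(** The images of the two components of phi are opposite; one lies in [LS (Uf tau)], the other
    decays, so both vanish. Then [prj phi] would be an eigenfunction for zeta and is 0. Hence phi is
    its own remainder, and |zeta|^k |phi| is at most a constant times lambda^k, where lambda <
    |zeta|. *)
Lemma shifted_inj phi : holder alpha phi -> shifted phi = (fun=> 0) -> phi = (fun=> 0).
Proof.
move=> hp E; have hpi := prj_holder hp; have hr := rem_holder hp.
have Ephi : phi = (fun z => prj phi z + rem phi z).
  by apply: funext => z; rewrite /rem addrC subrK.
have Es z : shifted (prj phi) z = - shifted (rem phi) z.
  have := congr1 (fun h => h z) E; rewrite {1}Ephi shifted_D // => /eqP.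
  by rewrite addr_eq0 => /eqP.
have pt : ptzero (shifted (prj phi)).
  have -> : shifted (prj phi) = (fun z => -1 * shifted (rem phi) z).
    by apply: funext => z; rewrite Es mulN1r.
  move=> z e e0; pose B := K * hnorm alpha phi.
  have l01 : 0 <= lambda < 1 by rewrite ltW.
  have [N0 HN] := geometric_tends0 (B * (cnorm zeta + lambda)) l01 e0.
  exists N0 => k /HN; apply: le_lt_trans; rewrite Mtau_n_Z; last exact: shifted_holder.
  rewrite Mtau_n_shifted // cnormM cnormN cnorm1 mul1r /shifted.
  apply: (le_trans (cnormD _ _)); rewrite cnormN cnormM.
  have h1 := (rem_hbound k hp).1 z; have h2 := (rem_hbound k.+1 hp).1 z.
  apply: (le_trans (lerD (ler_wpM2l (cnorm_ge0 zeta) h1) h2)).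
  by rewrite -/B exprSr le_eqVlt; apply/orP; left; apply/eqP; ring.
have p0 : prj phi = (fun=> 0).
  apply: (LS_eigen_zero zeta_Uv (prj_LS hp)).
  have E0 := LS_ptzero (shifted_LS (prj_LS hp)) pt.
  apply: funext => z; have /eqP := congr1 (fun h => h z) E0.
  by rewrite subr_eq0 eq_sym => /eqP.
have Er : rem phi = phi by apply: funext => z; rewrite /rem p0 subr0.
have Mphi : M phi = (fun z => zeta * phi z).
  by apply: funext => z; have /eqP := congr1 (fun h => h z) E; rewrite subr_eq0 eq_sym => /eqP.
have Mnphi k z : Mn k phi z = zeta ^+ k * phi z.
  elim: k z => [|k IH] z /=; first by rewrite expr0 mul1r.
  rewrite -/(Mn k) (_ : Mn k phi = (fun z => zeta ^+ k * phi z)); last exact: funext.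
  by rewrite MtauZ ?Mphi; [rewrite exprSr mulrA|exact: bc].
apply: funext => z; apply/eqP; rewrite -cnorm_eq0 eq_le cnorm_ge0 andbT.
apply: (@le_geometric_limit _ _ _ (K * hnorm alpha phi) r 0) => // k _; rewrite add0r.
have := (rem_hbound k hp).1 z; rewrite Er Mnphi cnormM cnormX.
by rewrite /r expr_div_n mulrA ler_pdivlMr ?exprn_gt0 // mulrC.
Qed.

(* The product of the factors M - a over the finitely many unimodular
   eigenvalues annihilates LS (Uf tau), which bounds the inverse of
   zeta - M there although no dimension is known to be finite. *)
Fixpoint kill (s : seq R[i]) phi : sphere R -> R[i] :=
  if s is a :: s' then kill s' (fun z => M phi z - a * phi z) else phi.

Lemma kill_eigen s n a f (c : nat -> R[i]) : eigen_family n a f ->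
  kill s (fun z => \sum_(i < n) c i * f i z) =
  (fun z => \sum_(i < n) (c i * \prod_(b <- s) (a i - b)) * f i z).
Proof.
move=> H; elim: s c => [|b s IH] c /=.
  by apply: funext => z; apply: eq_bigr => i _; rewrite big_nil mulr1.
rewrite (eigen_Mtau _ H).
have -> : (fun z => \sum_(i < n) c i * a i * f i z - b * \sum_(i < n) c i * f i z) =
  (fun z => \sum_(i < n) (c i * (a i - b)) * f i z).
  by apply: funext => z; rewrite mulr_sumr -sumrB; apply: eq_bigr => i _; ring.
rewrite (IH (fun i => c i * (a i - b))); apply: funext => z.
by apply: eq_bigr => i _; rewrite big_cons mulrA.
Qed.

(** With eta = (M - a) phi one has (zeta - a) phi = eta + (zeta - M) phi. Moreover zeta - M sends
    eta to (M - a) (zeta - M) phi, which is controlled, so the bound for eta comes from the shorter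
    list. *)
Lemma kill_bound (s : seq R[i]) : (forall a, a \in s -> Uv tau a) ->
  exists2 L : R, 0 <= L & forall phi A, holder alpha phi ->
    kill s phi = (fun=> 0) -> hbound alpha (shifted phi) A -> hbound alpha phi (L * A).
Proof.
have [C C0 HC] := Mtau_hbound alpha_gt0 tau_compact.
elim: s => [|a s IH] Hs.
  exists 1 => // phi A _ /= -> /hbound_ge0 A0; rewrite mul1r; split => [z|x y].
    by rewrite cnorm0.
  by rewrite subrr cnorm0 mulr_ge0 // powR_ge0.
have [L L0 HL] := IH (fun b bs => Hs b (mem_behead (s := a :: s) bs)).
have az : zeta - a != 0.
  by rewrite subr_eq0; apply/eqP => E; apply: zeta_Uv; rewrite E; apply: Hs; exact: mem_head.
exists ((cnorm (zeta - a))^-1 * (L * (C + cnorm a) + 1)).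
  by rewrite mulr_ge0 ?invr_ge0 // addr_ge0 // mulr_ge0 // addr_ge0 // ltW.
move=> phi A hp /= Ek hA.
pose eta z := M phi z - a * phi z.
have heta : holder alpha eta.
  by apply: holderB; [exact: holder_Mtau|exact: holderZ].
have bp := bc hp; have bMp := bc (holder_Mtau hp).
have Eeta : shifted eta = (fun z => M (shifted phi) z - a * shifted phi z).
  apply: funext => z; rewrite /shifted /eta.
  by rewrite !MtauB ?MtauZ //; [ring|exact: bcontZ|exact: bcontZ].
have hE : hbound alpha (shifted eta) ((C + cnorm a) * A).
  by rewrite Eeta mulrDl; apply: hboundB; [exact: HC|exact: hboundZ].
have := HL _ _ heta Ek hE => Heta.
have := hboundZ (zeta - a)^-1 (hboundD Heta hA); rewrite cnormV.
have -> : (fun z => (zeta - a)^-1 * (eta z + shifted phi z)) = phi.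
  by apply: funext => z; rewrite /eta /shifted; field.
congr hbound; ring.
Qed.

(** Dividing each coefficient by zeta - a_i solves the equation, but bounds the solution only in
    terms of the representation. The uniform constant comes from [kill_bound] applied to the list of
    all unimodular eigenvalues. *)
Lemma LS_resolvent : exists2 L : R, 0 <= L & forall psi A, LS (Uf tau) psi ->
  hbound alpha psi A ->
  exists theta, [/\ LS (Uf tau) theta, shifted theta = psi & hbound alpha theta (L * A)].
Proof.
have /finite_seqP[s Es] := Uv_finite.
have [|L L0 HL] := @kill_bound s; first by move=> a; rewrite Es.
exists L => // psi A /LS_eigen[n [c [a [f [H Epsi]]]]] hA.
have az i : (i < n)%N -> zeta - a i != 0.
  by move=> /H[_ Ua _ _ _]; rewrite subr_eq0; apply/eqP => E; apply: zeta_Uv; rewrite E.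
pose theta z := \sum_(i < n) (c i / (zeta - a i)) * f i z.
have Lt : LS (Uf tau) theta by exact: (eigen_LS (fun i => c i / (zeta - a i)) H).
have Et : shifted theta = psi.
  rewrite Epsi /shifted /theta (eigen_Mtau (fun i => c i / (zeta - a i)) H).
  apply: funext => z; rewrite mulr_sumr -sumrB; apply: eq_bigr => i _.
  by have := az i (ltn_ord i) => ?; field.
exists theta; split => //; apply: HL; [exact: LS_holder| |by rewrite Et].
rewrite (kill_eigen s (fun i => c i / (zeta - a i)) H); apply: funext => z.
apply: big1 => i _; have [_ Ua _ _ _] := H i (ltn_ord i).
have ais : a i \in s by move: Ua; rewrite Es.
by rewrite (big_rem _ ais) /= subrr mul0r mulr0 mul0r.
Qed.

(** The tail constant of the geometric series whose n-th term is bounded by (K / |zeta|) r^n times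
    the norm of phi. *)
Definition neumann_bound : R := 2 * (K / cnorm zeta / (1 - r)).

Lemma neumann_bound_ge0 : 0 <= neumann_bound.
Proof.
by case/andP: r01 => _ r1; rewrite mulr_ge0 // divr_ge0 ?divr_ge0 // subr_ge0 ltW.
Qed.

Lemma rem_resolvent phi : holder alpha phi ->
  exists S : sphere R -> R[i], [/\ holder alpha S, shifted S = rem phi &
    forall N, hbound alpha (fun z => S z - \sum_(n < N) zeta ^- n.+1 * Mn n (rem phi) z)
      (neumann_bound * hnorm alpha phi * r ^+ N)].
Proof.
move=> hp; have H0 := hnorm_ge0 alpha_gt0 hp; have hr := rem_holder hp.
pose A := K / cnorm zeta * hnorm alpha phi.
have A0 : 0 <= A by rewrite mulr_ge0 // divr_ge0.
pose u n z := zeta ^- n.+1 * Mn n (rem phi) z.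
have hu n : hbound alpha (u n) (A * r ^+ n).
  have := hboundZ (zeta ^- n.+1) (rem_hbound n hp); congr hbound.
  rewrite cnormV cnormX /A /r expr_div_n exprS.
  by field; rewrite expf_neq0 gt_eqF.
have [S HS] := holder_geometric_series A0 r01 hu.
have {}HS N : hbound alpha (fun z => S z - \sum_(n < N) u n z)
    (neumann_bound * hnorm alpha phi * r ^+ N).
  by have := HS N; congr hbound; rewrite /neumann_bound /A; ring.
have hS : holder alpha S.
  by apply: (hbound_holder (A := neumann_bound * hnorm alpha phi * r ^+ 0));
     have := HS 0%N; congr hbound; apply: funext => z; rewrite big_ord0 subr0.
exists S; split => //; apply: funext => z.
have hsum N : holder alpha (fun z => \sum_(n < N) u n z).
  by apply: (@holder_sum N (fun n => Mn n (rem phi)) (fun n => zeta ^- n.+1)) => i _;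
     exact: holder_Mtau_n.
(* The Neumann sum telescopes under zeta - M. *)
have sum_shift N : shifted (fun z => \sum_(n < N) u n z) z =
    rem phi z - zeta ^- N * Mn N (rem phi) z.
  rewrite /shifted (@Mtau_sum N (fun n => Mn n (rem phi)) (fun n => zeta ^- n.+1)); last first.
    by move=> i _; exact: holder_Mtau_n.
  rewrite mulr_sumr -sumrB; elim: N => [|N IH].
    by rewrite big_ord0 expr0 invr1 mul1r subrr.
  rewrite big_ord_recr /= IH /u -/(Mn N) exprS.
  by field; rewrite expf_neq0 // zeta0.
have [C C0 HC] := Mtau_hbound alpha_gt0 tau_compact.
pose B := neumann_bound * hnorm alpha phi.
(* [shifted S] and [rem phi] are both limits of the shifted partial sums: the former by boundedness
   of [M], the latter by telescoping. *)
apply: (@geometric_limit_unique R (fun N => shifted (fun z => \sum_(n < N) u n z) z)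
  _ _ ((cnorm zeta + C) * B) (K * hnorm alpha phi) r) => // N.
  have -> : shifted S z - shifted (fun z => \sum_(n < N) u n z) z =
     shifted (fun z => S z - \sum_(n < N) u n z) z.
    by rewrite {3}/shifted MtauB; [rewrite /shifted; ring|exact: bc|exact: bc].
  have h1 := HS N; have h2 := HC _ _ h1; apply: (le_trans (cnormD _ _)).
  rewrite cnormN cnormM -mulrA mulrDl; apply: lerD; last exact: h2.1.
  by rewrite ler_wpM2l //; exact: h1.1.
rewrite sum_shift opprB addrC subrK cnormM cnormV cnormX.
rewrite ler_pdivrMl ?exprn_gt0 //; apply: (le_trans ((rem_hbound N hp).1 z)).
rewrite /r expr_div_n le_eqVlt; apply/orP; left; apply/eqP.
by field; rewrite expf_neq0 // gt_eqF.
Qed.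

Lemma shifted_surj : exists2 L : R, 0 <= L & forall phi, holder alpha phi ->
  exists theta, [/\ holder alpha theta, shifted theta = phi &
    hbound alpha theta (L * hnorm alpha phi)].
Proof.
have [L L0 HL] := LS_resolvent.
exists (L * (1 + K) + neumann_bound).
  by rewrite addr_ge0 ?neumann_bound_ge0 // mulr_ge0 // addr_ge0.
move=> phi hp; have hpn := hbound_hnorm alpha_gt0 hp.
(* Decay at n = 0 bounds I - pi, and thereby pi, by 1 + K. *)
have h0 := rem_hbound 0 hp; rewrite expr0 mulr1 in h0.
have hprj : hbound alpha (prj phi) ((1 + K) * hnorm alpha phi).
  have := hboundB hpn h0; rewrite mulrDl mul1r; congr hbound.
  by apply: funext => z; rewrite /= /rem; ring.
have [th [Lth Eth Bth]] := HL _ _ (prj_LS hp) hprj.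
have [S [hS ES BS]] := rem_resolvent hp.
have hth := LS_holder Lth.
exists (fun z => th z + S z); split.
- have := holder_lin 1 1 hth hS; congr holder.
  by apply: funext => z; rewrite !mul1r.
- by rewrite shifted_D // Eth ES; apply: funext => z; rewrite /rem addrC subrK.
- have := BS 0%N; rewrite expr0 mulr1.
  have -> : (fun z => S z - \sum_(n < 0) zeta ^- n.+1 * Mn n (rem phi) z) = S.
    by apply: funext => z; rewrite big_ord0 subr0.
  move=> BS0; have := hboundD Bth BS0; congr hbound; ring.
Qed.

Lemma shifted_eq phi psi : holder alpha phi -> holder alpha psi ->
  shifted phi = shifted psi -> phi = psi.
Proof.
move=> hp hq E; have hd := holderB hp hq.
have : shifted (fun z => phi z - psi z) = (fun=> 0).
  apply: funext => z; have := congr1 (fun h => h z) E.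
  rewrite /shifted MtauB; [|exact: bc|exact: bc].
  move=> Ez; have -> : zeta * (phi z - psi z) - (M phi z - M psi z) =
    zeta * phi z - M phi z - (zeta * psi z - M psi z) by ring.
  by rewrite Ez subrr.
move/(shifted_inj hd) => E0; apply: funext => z.
by have /eqP := congr1 (fun h => h z) E0; rewrite subr_eq0 => /eqP.
Qed.

(** T chooses a preimage for each function separately; injectivity of zeta - M makes the choice
    linear and a left inverse. *)
Lemma resolvent_exists : exists T, resolvent_op tau alpha zeta T.
Proof.
have [L L0 HL] := shifted_surj.
have ex phi : exists theta, holder alpha phi -> [/\ holder alpha theta,
    shifted theta = phi & hbound alpha theta (L * hnorm alpha phi)].
  (* Outside C^alpha the value of T is immaterial. *)
  have [hp|np] := pselect (holder alpha phi); last by exists phi.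
  by have [th Hth] := HL _ hp; exists th.
have [T HT] := choice ex; exists T; split.
- by move=> phi /HT[].
- move=> a b phi psi hp hq; have hl := holder_lin a b hp hq.
  have [h1 E1 _] := HT _ hl; have [h2 E2 _] := HT _ hp; have [h3 E3 _] := HT _ hq.
  apply: shifted_eq => //; first exact: holder_lin.
  rewrite E1 shifted_D; [|exact: holderZ|exact: holderZ].
  by rewrite !shifted_Z // E2 E3.
- exists (2 * L) => phi hp; have [_ _ h] := HT _ hp.
  by rewrite -mulrA; exact: hnorm_le.
- move=> phi hp; have [h1 E1 _] := HT _ (shifted_holder hp).
  exact: shifted_eq.
- by move=> phi /HT[_ E _].
Qed.

(** The preimage of psi inside the span is the value of T, because T is a left inverse of zeta - M.
    So T restricts to the span and inverts there. *)
Lemma resolvent_LS T psi : resolvent_op tau alpha zeta T -> LS (Uf tau) psi ->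
  LS (Uf tau) (T psi) /\ shifted (T psi) = psi.
Proof.
move=> [_ _ _ HT _] Lpsi; have hpsi := LS_holder Lpsi.
have [L L0 HL] := LS_resolvent.
have [th [Lth Eth _]] := HL _ _ Lpsi (hbound_hnorm alpha_gt0 hpsi).
have -> : T psi = th by rewrite -[RHS](HT th (LS_holder Lth)) -/(shifted th) Eth.
by [].
Qed.

(** T phi is T (prj phi) plus the Neumann sum S, since this sum is also mapped to phi by zeta - M.
    The tail bound is linear in the norm of phi, whence convergence in operator norm. *)
Lemma resolvent_expansion T : resolvent_op tau alpha zeta T ->
  forall e : R, 0 < e -> exists N0 : nat, forall N : nat, (N0 <= N)%N ->
  forall phi, holder alpha phi ->
    hnorm alpha (fun z => T phi z - T (prj phi) z
      - \sum_(n < N) zeta ^- n.+1 * Mn n (fun w => phi w - prj phi w) z)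
    <= e * hnorm alpha phi.
Proof.
move=> HTop e e0.
have [N0 HN0] := geometric_tends0 (2 * neumann_bound) r01 e0.
exists N0 => N /HN0 NN phi hp; have [S [hS ES BS]] := rem_resolvent hp.
have [LT ET] := resolvent_LS HTop (prj_LS hp); have hT := LS_holder LT.
have hsum : holder alpha (fun z => T (prj phi) z + S z).
  have := holder_lin 1 1 hT hS; congr holder.
  by apply: funext => z; rewrite !mul1r.
have ETphi : T phi = (fun z => T (prj phi) z + S z).
  case: HTop => _ _ _ HT _; rewrite -[RHS](HT _ hsum) -/(shifted _) shifted_D // ET ES.
  by congr T; apply: funext => z; rewrite /rem addrC subrK.
have -> : (fun z => T phi z - T (prj phi) z
      - \sum_(n < N) zeta ^- n.+1 * Mn n (fun w => phi w - prj phi w) z) =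
  (fun z => S z - \sum_(n < N) zeta ^- n.+1 * Mn n (rem phi) z).
  by apply: funext => z; rewrite ETphi; congr (_ - _); ring.
apply: (le_trans (hnorm_le (BS N))).
have -> : 2 * (neumann_bound * hnorm alpha phi * r ^+ N) =
  2 * neumann_bound * r ^+ N * hnorm alpha phi by ring.
by rewrite ler_wpM2r ?(hnorm_ge0 alpha_gt0) // ltW.
Qed.

End Resolvent.
End PeripheralSpectrum.

Theorem mainTheorem13 (R : realType) (tau : probability (RatM R) R)
  (pi : (sphere R -> R[i]) -> sphere R -> R[i]) (alpha lambda : R) :
  compact_supp tau ->
  Jker (Gtau tau) = set0 ->
  Julia (Gtau tau) !=set0 ->
  Stau tau `<=` Fatou (Gtau tau) ->
  is_pi_tau tau pi ->
  0 < alpha < 1 -> 0 < lambda < 1 ->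
  (exists2 K : R, 0 < K & forall phi, holder alpha phi -> forall n : nat,
     hnorm alpha (Mtau_n tau n (fun z => phi z - pi phi z))
       <= K * lambda ^+ n * hnorm alpha phi) ->
  LS (Uf tau) `<=` holder alpha ->
  (* (1) *)
  spec_alpha tau alpha `<=` [set zeta | cnorm zeta <= lambda] `|` Uv tau
  /\
  (* (2) *)
  (forall zeta : R[i], ~ (cnorm zeta <= lambda) -> ~ Uv tau zeta ->
   forall T, resolvent_op tau alpha zeta T ->
   (forall psi, LS (Uf tau) psi -> LS (Uf tau) (Mtau tau psi)) /\
   exists Rinv : (sphere R -> R[i]) -> sphere R -> R[i],
     [/\ (* Rinv is the inverse of (zeta I - M_tau) restricted to LS(U_f) *)
       forall psi, LS (Uf tau) psi -> LS (Uf tau) (Rinv psi) /\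
         (fun z => zeta * Rinv psi z - Mtau tau (Rinv psi) z) = psi,
       forall psi, LS (Uf tau) psi ->
         Rinv (fun z => zeta * psi z - Mtau tau psi z) = psi &
       (* T = Rinv o pi + sum_n M^n/zeta^(n+1) (I - pi), series converging
          in the operator norm of C^alpha *)
       forall e : R, 0 < e -> exists N0 : nat, forall N : nat, (N0 <= N)%N ->
         forall phi, holder alpha phi ->
         hnorm alpha (fun z => T phi z - Rinv (pi phi) z
            - \sum_(n < N) zeta ^- n.+1 * Mtau_n tau n (fun w => phi w - pi phi w) z)
           <= e * hnorm alpha phi]).
Proof.
move=> ctau _ _ _ pi_tau /andP[al0 _] /andP[la0 la1] [K K0 decay] LSh.
have gt zeta : ~ (cnorm zeta <= lambda) -> lambda < cnorm zeta.
  by move=> /negP; rewrite -ltNge.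
split.
  move=> zeta sp; apply: contrapT => /not_orP[/gt zl zU]; apply: sp.
  exact: (resolvent_exists al0 ctau LSh pi_tau la0 la1 (ltW K0) decay zl zU).
move=> zeta /gt zl zU T HT; split; first exact: (LS_Mtau al0 LSh).
(* T itself represents the inverse of the restricted operator, as it preserves the span. *)
exists T; split.
- by move=> psi; exact: (resolvent_LS al0 ctau LSh pi_tau zU HT).
- by move=> psi /LSh hpsi; case: HT => _ _ _ + _; apply.
- exact: (resolvent_expansion al0 ctau LSh pi_tau la0 (ltW K0) decay zl zU HT).
Qed.
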